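(* Let $C$ be a geometrically integral smooth projective curve of genus $g$ over a field $k$ with a finite morphism $\pi:C\to\mathbb P^1$ of degree $n\ge2$, and let $\mathcal L$ be a line bundle on $C$. Let $L$ be the function field of $C$ and $K$ that of $\mathbb P^1$, and let $F_0,\dots,F_{n-1}$ and $G_0,\dots,G_{n-1}$ be the $K$-subspaces of $L$ defined below. Fix $i,j\in\{0,\dots,n-1\}$ and let $k'$ be the smallest integer in $\{0,\dots,n-1\}$ such that $F_iG_j\subseteq G_{k'}$. Then $a_{k'}(\mathcal L,\pi)\le a_i(\mathcal O_C,\pi)+a_j(\mathcal L,\pi)$. In particular, for any $i,j$ with $i,j,i+j\in\{0,\dots,n-1\}$, if $a_{i+j}(\mathcal L,\pi)>a_i(\mathcal O_C,\pi)+a_j(\mathcal L,\pi)$, then there exists an integer $1<m<n$ such that $L/K$ has an intermediate field of degree $m$ over $K$ and $(i\bmod m)+(j\bmod m)\ne(i+j)\bmod m$.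
   Context: For a line bundle $\mathcal M$ on $C$, the logarithmic successive minima $a_0(\mathcal M,\pi)\le\dots\le a_{n-1}(\mathcal M,\pi)$ are the unique integers with $\pi_*\mathcal M\simeq\mathcal O_{\mathbb P^1}(-a_0)\oplus\dots\oplus\mathcal O_{\mathbb P^1}(-a_{n-1})$. Let $\nu$ be the generic point of $\mathbb P^1$ and $\eta$ that of $C$; $\pi$ induces $K$-linear isomorphisms $\phi_1:(\mathcal O_C)_\eta=L\to(\pi_*\mathcal O_C)_\nu$ and $\phi_2:\mathcal L_\eta\cong L\to(\pi_*\mathcal L)_\nu$ compatible with the multiplication map $\mathcal O_C\otimes\mathcal L\to\mathcal L$ and its pushforward $\pi_*\mathcal O_C\otimes\pi_*\mathcal L\to\pi_*\mathcal L$ (so that on generic fibres the latter is multiplication in $L$). Fixing such splittings, set $F_i=\phi_1^{-1}\big((\mathcal O_{\mathbb P^1}(-a_0(\mathcal O_C))\oplus\dots\oplus\mathcal O_{\mathbb P^1}(-a_i(\mathcal O_C)))_\nu\big)$ and $G_i=\phi_2^{-1}\big((\mathcal O_{\mathbb P^1}(-a_0(\mathcal L))\oplus\dots\oplus\mathcal O_{\mathbb P^1}(-a_i(\mathcal L)))_\nu\big)$. $F_iG_j=\{ab:a\in F_i,b\in G_j\}$. $a\bmod b$ is the remainder. *)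

(* Defs.v *)
From HB Require Import structures.
From mathcomp Require Import all_boot all_order all_algebra all_field.
From mathcomp Require Import boolp classical_sets topology.
From mathcomp Require Import mpoly.

Set Implicit Arguments.
Unset Strict Implicit.
Unset Printing Implicit Defensive.

Import Order.TTheory GRing.Theory Num.Theory.
Local Open Scope classical_set_scope.
Local Open Scope ring_scope.

Record opens (X : topologicalType) := Opens {
  pts :> set X;
  pts_open : open pts }.

Definition oT (X : topologicalType) : opens X := Opens openT.

Definition oI (X : topologicalType) (U V : opens X) : opens X :=
  Opens (openI (pts_open U) (pts_open V)).

Definition opreim (X Y : topologicalType) (f : X -> Y) (fc : continuous f)
    (V : opens Y) : opens X :=
  Opens ((continuousP f).1 fc _ (pts_open V)).

Lemma sub_oT (X : topologicalType) (U : opens X) : U `<=` oT X.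
Proof. by []. Qed.

(* A topological space with a sheaf of commutative rings.  The zero ring has to
   be allowed (sections over the empty set), hence [comPzRingType].  In the
   gluing axiom, agreement on overlaps is tested on all V contained in both
   W i and W j. *)
Record ringed_space := RingedSpace {
  space :> topologicalType;
  sec : opens space -> comPzRingType;
  res : forall U V : opens space, V `<=` U -> {rmorphism sec U -> sec V};
  res_id : forall (U : opens space) (UU : U `<=` U) (s : sec U), res UU s = s;
  res_comp : forall (U V W : opens space)
    (VU : V `<=` U) (WV : W `<=` V) (WU : W `<=` U) (s : sec U),
    res WV (res VU s) = res WU s;
  sec_sep : forall (I : Type) (U : opens space) (W : I -> opens space)
    (WU : forall i, W i `<=` U), U `<=` \bigcup_i W i ->
    forall s t : sec U, (forall i, res (WU i) s = res (WU i) t) -> s = t;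
  sec_glue : forall (I : Type) (U : opens space) (W : I -> opens space)
    (WU : forall i, W i `<=` U), U `<=` \bigcup_i W i ->
    forall s : forall i, sec (W i),
    (forall i j (V : opens space) (Vi : V `<=` W i) (Vj : V `<=` W j),
       res Vi (s i) = res Vj (s j)) ->
    exists t : sec U, forall i, res (WU i) t = s i }.

(* The germ of f at x is a unit of the stalk. *)
Definition unit_at (X : ringed_space) (U : opens X) (f : sec U) (x : X) : Prop :=
  exists (V : opens X) (VU : V `<=` U),
    pts V x /\ exists t : sec V, res VU f * t = 1.

Lemma unit_at_open (X : ringed_space) (U : opens X) (f : sec U) :
  open [set x | unit_at f x].
Proof.
rewrite openE => x [V [VU [Vx ft]]]; rewrite /interior nbhsE.
exists (pts V); first by split=> //; exact: pts_open.
by move=> y Vy; exists V, VU.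
Qed.

(* D(f), the locus where f is invertible. *)
Definition D (X : ringed_space) (U : opens X) (f : sec U) : opens X :=
  Opens (unit_at_open f).

Lemma D_sub (X : ringed_space) (U : opens X) (f : sec U) : D f `<=` U.
Proof. by move=> x [V [VU [/VU]]]. Qed.

(* Every stalk is nonzero and its non-units are closed under addition. *)
Definition locally_ringed (X : ringed_space) : Prop :=
  forall (U : opens X) (x : X), pts U x ->
    (1 : sec U) <> 0 /\
    forall f h : sec U, unit_at (f + h) x -> unit_at f x \/ unit_at h x.

Definition prime_ideal (A : comPzRingType) (p : set A) : Prop :=
  [/\ p 0, forall a b, p a -> p b -> p (a + b), forall a b, p b -> p (a * b),
      ~ p 1 & forall a b, p (a * b) -> p a \/ p b].

(* The canonical map from U to Spec O(U), sending x to the prime ideal of the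
   functions that are not invertible at x, is an isomorphism of ringed spaces:
   it is bijective, the D(f) form a basis of the topology of U, and O(D(f)) is
   the localization O(U)_f. *)
Definition affine (X : ringed_space) (U : opens X) : Prop :=
  [/\ forall p : set (sec U), prime_ideal p ->
        exists! x : X, pts U x /\ forall f, p f <-> ~ unit_at f x,
      forall (V : opens X) x, V `<=` U -> pts V x ->
        exists f : sec U, unit_at f x /\ D f `<=` V,
      forall (f : sec U) (s : sec (D f)), exists (m : nat) (a : sec U),
        res (@D_sub X U f) f ^+ m * s = res (@D_sub X U f) a
    & forall f a : sec U, res (@D_sub X U f) a = 0 ->
        exists m : nat, f ^+ m * a = 0].

Record scheme := Scheme {
  rs :> ringed_space;
  scheme_local : locally_ringed rs;
  scheme_affine : forall x : rs, exists U : opens rs, pts U x /\ affine U }.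

Definition integral_domain (A : comPzRingType) : Prop :=
  (1 : A) <> 0 /\ forall a b : A, a * b = 0 -> a = 0 \/ b = 0.

Definition integral (X : scheme) : Prop :=
  inhabited X /\ forall (U : opens X) x, pts U x -> integral_domain (sec U).

Definition generic_point (X : scheme) (x : X) : Prop := closure [set x] = setT.

Definition irreducible_closed (X : topologicalType) (Z : set X) : Prop :=
  [/\ closed Z, Z !=set0 & forall A B, closed A -> closed B ->
      Z `<=` A `|` B -> Z `<=` A \/ Z `<=` B].

Definition has_chain (X : topologicalType) (d : nat) : Prop :=
  exists Z : 'I_d.+1 -> set X, (forall i, irreducible_closed (Z i)) /\
    forall i j : 'I_d.+1, (i < j)%N -> Z i `<` Z j.

Definition dimension (X : topologicalType) (d : nat) : Prop :=
  has_chain X d /\ ~ has_chain X d.+1.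

Record smor (X Y : scheme) := Smor {
  fn :> X -> Y;
  fn_cont : continuous fn;
  pull : forall V : opens Y, {rmorphism sec V -> sec (opreim fn_cont V)};
  pull_res : forall (V W : opens Y) (WV : W `<=` V)
    (fWV : opreim fn_cont W `<=` opreim fn_cont V) (s : sec V),
    pull W (res WV s) = res fWV (pull V s);
  pull_local : forall (V : opens Y) (s : sec V) (x : X),
    unit_at (pull V s) x -> unit_at s (fn x) }.

Definition opre (X Y : scheme) (f : smor X Y) (V : opens Y) : opens X :=
  opreim (@fn_cont X Y f) V.

(* r and q being morphisms to Y and Z, [factors r p q] says that q = p o r.
   Sections over the (equal) preimages are compared after restriction. *)
Definition factors (X Y Z : scheme)
    (r : smor X Y) (p : smor Y Z) (q : smor X Z) : Prop :=
  (forall x, p (r x) = q x) /\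
  forall (V : opens Z) (s : sec V) (U : opens X)
    (Ur : U `<=` opre r (opre p V)) (Uq : U `<=` opre q V),
    res Ur (pull r (opre p V) (pull p V s)) = res Uq (pull q V s).

Definition smor_eq (X Y : scheme) (f h : smor X Y) : Prop :=
  (forall x, f x = h x) /\
  forall (V : opens Y) (s : sec V) (U : opens X)
    (Uf : U `<=` opre f V) (Uh : U `<=` opre h V),
    res Uf (pull f V s) = res Uh (pull h V s).

Definition finite_mor (X Y : scheme) (f : smor X Y) : Prop :=
  forall V : opens Y, affine V -> affine (opre f V) /\
    exists (r : nat) (x : 'I_r -> sec (opre f V)),
      forall s, exists c : 'I_r -> sec V, s = \sum_i pull f V (c i) * x i.

(* f is a homeomorphism onto a closed subset and O_Y -> f_* O_X is surjective. *)
Definition closed_immersion (X Y : scheme) (f : smor X Y) : Prop :=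
  [/\ injective f,
      forall Z : set X, closed Z -> closed (f @` Z)
    & forall (V : opens Y) (s : sec (opre f V)) (y : Y), pts V y ->
        exists (W : opens Y) (WV : opre f W `<=` opre f V) (t : sec W),
          pts W y /\ pull f W t = res WV s].

Record scheme_over (k : fieldType) := SchemeOver {
  sch :> scheme;
  kstr : {rmorphism k -> sec (oT sch)} }.

Definition scal (k : fieldType) (X : scheme_over k) (U : opens X) (c : k) : sec U :=
  res (@sub_oT X U) (kstr X c).

(* h being a homomorphism from k to k', f is a morphism over Spec k' -> Spec k. *)
Definition mor_over (k k' : fieldType) (h : k -> k') (X : scheme_over k')
    (Y : scheme_over k) (f : smor X Y) : Prop :=
  forall (V : opens Y) (c : k), pull f V (scal V c) = scal (opre f V) (h c).

Definition kmor (k : fieldType) (X Y : scheme_over k) (f : smor X Y) : Prop :=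
  mor_over id f.

(* p exhibits X' as the fibre product of X and Spec k' over Spec k. *)
Definition base_change (k k' : fieldType) (h : {rmorphism k -> k'})
    (X : scheme_over k) (X' : scheme_over k') (p : smor X' X) : Prop :=
  mor_over h p /\
  forall (T : scheme_over k') (q : smor T X), mor_over h q ->
    exists r : smor T X', [/\ kmor r, factors r p q
      & forall r' : smor T X', kmor r' -> factors r' p q -> smor_eq r r'].

Definition geometrically_integral (k : fieldType) (X : scheme_over k) : Prop :=
  forall (k' : fieldType) (h : {rmorphism k -> k'}) (X' : scheme_over k')
    (p : smor X' X), base_change h p -> integral X'.

Definition finite_type_alg (k : fieldType) (A : comPzRingType)
    (i : k -> A) : Prop :=
  exists (r : nat) (phi : {rmorphism {mpoly k[r]} -> A}),
    (forall c, phi c%:MP = i c) /\ forall a, exists p, phi p = a.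

(* The infinitesimal lifting property along B -> B' with kernel of square 0. *)
Definition formally_smooth_alg (k : fieldType) (A : comPzRingType)
    (i : k -> A) : Prop :=
  forall (B B' : comPzRingType) (q : {rmorphism B -> B'}),
    (forall b', exists b, q b = b') ->
    (forall x y, q x = 0 -> q y = 0 -> x * y = 0) ->
    forall (h : {rmorphism k -> B}) (phi : {rmorphism A -> B'}),
    (forall c, phi (i c) = q (h c)) ->
    exists psi : {rmorphism A -> B},
      (forall c, psi (i c) = h c) /\ forall a, q (psi a) = phi a.

(* Smooth = locally of finite presentation and formally smooth; over a field,
   finite type and finite presentation coincide. *)
Definition smooth (k : fieldType) (X : scheme_over k) : Prop :=
  forall x : X, exists U : opens X, [/\ pts U x, affine U,
    finite_type_alg (@scal k X U) & formally_smooth_alg (@scal k X U)].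

(* P is the projective N-space over k: it is covered by affine opens chart i,
   coord i j = X_j / X_i lives on chart i, the ring of chart i is the polynomial
   ring over k in the X_j / X_i for j != i, and the charts are glued as usual. *)
Record proj_space (k : fieldType) (N : nat) (P : scheme_over k) := ProjSpace {
  chart : 'I_N.+1 -> opens P;
  coord : forall i : 'I_N.+1, 'I_N.+1 -> sec (chart i);
  chart_affine : forall i, affine (chart i);
  chart_cover : forall x : P, exists i, pts (chart i) x;
  chart_poly : forall i,
    exists phi : {rmorphism {mpoly k[N]} -> sec (chart i)},
    [/\ bijective phi, forall c, phi c%:MP = scal (chart i) c
      & forall j, phi 'X_j = coord i (lift i j)];
  coord_diag : forall i, coord i i = 1;
  chart_overlap : forall i j x, pts (chart i) x ->
    (pts (chart j) x <-> unit_at (coord i j) x);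
  coord_cocycle : forall i j l (W : opens P)
    (Wi : W `<=` chart i) (Wj : W `<=` chart j),
    res Wi (coord i l) = res Wi (coord i j) * res Wj (coord j l) }.

Definition projective (k : fieldType) (X : scheme_over k) : Prop :=
  exists (N : nat) (P : scheme_over k), inhabited (proj_space N P) /\
    exists f : smor X P, kmor f /\ closed_immersion f.

(* dim_k H^1(X, O_X) = g, computed as the Cech cohomology of a cover by two
   affine opens U and V (such a cover exists on any projective curve): the
   quotient of O(U :&: V) by O(U) + O(V) has a k-basis with g elements. *)
Definition genus (k : fieldType) (X : scheme_over k) (g : nat) : Prop :=
  exists U V : opens X, [/\ affine U, affine V, U `|` V = setT &
    exists b : 'I_g -> sec (oI U V), forall s : sec (oI U V),
      exists! c : {ffun 'I_g -> k}, exists (u : sec U) (v : sec V),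
        s = \sum_i scal (oI U V) (c i) * b i
            + @res X U (oI U V) (@subIsetl _ U V) u
            + @res X V (oI U V) (@subIsetr _ U V) v].

Record smooth_projective_curve (k : fieldType) (g : nat) (C : scheme_over k)
    : Prop := SmoothProjectiveCurve {
  curve_geom_integral : geometrically_integral C;
  curve_smooth : smooth C;
  curve_projective : projective C;
  curve_dim : dimension C 1;
  curve_genus : genus C g }.

Record omodule (X : ringed_space) := OModule {
  msec : forall U : opens X, lmodType (sec U);
  mres : forall U V : opens X, V `<=` U -> msec U -> msec V;
  mres_linear : forall (U V : opens X) (VU : V `<=` U) (a : sec U)
    (s t : msec U), mres VU (a *: s + t) = res VU a *: mres VU s + mres VU t;
  mres_id : forall (U : opens X) (UU : U `<=` U) (s : msec U), mres UU s = s;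
  mres_comp : forall (U V W : opens X)
    (VU : V `<=` U) (WV : W `<=` V) (WU : W `<=` U) (s : msec U),
    mres WV (mres VU s) = mres WU s;
  msec_sep : forall (I : Type) (U : opens X) (W : I -> opens X)
    (WU : forall i, W i `<=` U), U `<=` \bigcup_i W i ->
    forall s t : msec U, (forall i, mres (WU i) s = mres (WU i) t) -> s = t;
  msec_glue : forall (I : Type) (U : opens X) (W : I -> opens X)
    (WU : forall i, W i `<=` U), U `<=` \bigcup_i W i ->
    forall s : forall i, msec (W i),
    (forall i j (V : opens X) (Vi : V `<=` W i) (Vj : V `<=` W j),
       mres Vi (s i) = mres Vj (s j)) ->
    exists t : msec U, forall i, mres (WU i) t = s i }.

Record omod_hom (X : ringed_space) (M N : omodule X) := OmodHom {
  hom :> forall U : opens X, {linear msec M U -> msec N U};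
  hom_res : forall (U V : opens X) (VU : V `<=` U) (s : msec M U),
    hom V (mres VU s) = mres VU (hom U s) }.

Section StructureSheaf.
Variable X : ringed_space.

Let omsec (U : opens X) : lmodType (sec U) := (sec U)^o.
Let omres (U V : opens X) (VU : V `<=` U) : omsec U -> omsec V := res VU.

Let omres_linear (U V : opens X) (VU : V `<=` U) (a : sec U) (s t : omsec U) :
  omres VU (a *: s + t) = res VU a *: omres VU s + omres VU t.
Proof. by rewrite /omres rmorphD rmorphM. Qed.

Definition struct_sheaf : omodule X :=
  @OModule X omsec omres omres_linear
    (@res_id X) (@res_comp X) (@sec_sep X) (@sec_glue X).
End StructureSheaf.

(* The S-module V seen as an R-module through f. *)
Definition restr_scalars (R S : comPzRingType) (f : {rmorphism R -> S})
  (V : lmodType S) : Type := V.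

Section RestrictionOfScalars.
Variables (R S : comPzRingType) (f : {rmorphism R -> S}) (V : lmodType S).
Local Notation W := (restr_scalars f V).

HB.instance Definition _ := GRing.Zmodule.on W.

Let sc (a : R) (v : W) : W := f a *: (v : V).

Let scA a b v : sc a (sc b v) = sc (a * b) v.
Proof. by rewrite /sc rmorphM scalerA. Qed.
Let sc1 : left_id 1 sc.
Proof. by move=> v; rewrite /sc rmorph1 scale1r. Qed.
Let scDr : right_distributive sc +%R.
Proof. by move=> a u v; rewrite /sc; exact: scalerDr. Qed.
Let scDl v : {morph sc^~ v : a b / a + b}.
Proof. by move=> a b; rewrite /sc rmorphD; exact: scalerDl. Qed.

HB.instance Definition _ :=
  GRing.Zmodule_isLmodule.Build R W scA sc1 scDr scDl.
End RestrictionOfScalars.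

Section Pushforward.
Variables (X Y : scheme) (f : smor X Y) (M : omodule X).

Lemma opre_sub (V W : opens Y) : W `<=` V -> opre f W `<=` opre f V.
Proof. by move=> WV x; exact: WV. Qed.

Let psec (V : opens Y) : lmodType (sec V) :=
  restr_scalars (pull f V) (msec M (opre f V)).
Let pres (V W : opens Y) (WV : W `<=` V) : psec V -> psec W :=
  @mres _ M _ _ (opre_sub WV).

Let pres_linear (V W : opens Y) (WV : W `<=` V) (a : sec V) (s t : psec V) :
  pres WV (a *: s + t) = res WV a *: pres WV s + pres WV t.
Proof.
rewrite /pres; have -> : res WV a *: (mres (opre_sub WV) s : psec W) =
  res (opre_sub WV) (pull f V a) *: mres (opre_sub WV) s :> msec M (opre f W).
  by rewrite -(pull_res WV).
exact: mres_linear.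
Qed.

Let pres_id (V : opens Y) (VV : V `<=` V) (s : psec V) : pres VV s = s.
Proof. exact: mres_id. Qed.

Let pres_comp (U V W : opens Y) (VU : V `<=` U) (WV : W `<=` V)
  (WU : W `<=` U) (s : psec U) : pres WV (pres VU s) = pres WU s.
Proof. exact: mres_comp. Qed.

Let psec_sep (I : Type) (U : opens Y) (W : I -> opens Y)
    (WU : forall i, W i `<=` U) : U `<=` \bigcup_i W i ->
  forall s t : psec U, (forall i, pres (WU i) s = pres (WU i) t) -> s = t.
Proof.
move=> cov; apply: (@msec_sep _ M I _ (fun i => opre f (W i))).
by move=> x /cov [i _ Wx]; exists i.
Qed.

Let psec_glue (I : Type) (U : opens Y) (W : I -> opens Y)
    (WU : forall i, W i `<=` U) : U `<=` \bigcup_i W i ->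
  forall s : forall i, psec (W i),
  (forall i j (V : opens Y) (Vi : V `<=` W i) (Vj : V `<=` W j),
     pres Vi (s i) = pres Vj (s j)) ->
  exists t : psec U, forall i, pres (WU i) t = s i.
Proof.
move=> cov s sE.
apply: (@msec_glue _ M I _ (fun i => opre f (W i))
  (fun i => opre_sub (WU i))); first by move=> x /cov [i _ Wx]; exists i.
move=> i j V Vi Vj.
have IV : V `<=` opre f (oI (W i) (W j)) by move=> x Vx; split; [exact: Vi|exact: Vj].
have := congr1 (mres IV)
  (sE i j (oI (W i) (W j)) (@subIsetl _ _ _) (@subIsetr _ _ _)).
by rewrite !mres_comp.
Qed.

Definition pushforward : omodule Y :=
  OModule pres_linear pres_id pres_comp psec_sep psec_glue.
End Pushforward.

(* Multiplication by e is an isomorphism from O_U to the restriction of M to U. *)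
Definition generator (X : ringed_space) (M : omodule X) (U : opens X)
    (e : msec M U) : Prop :=
  forall (W : opens X) (WU : W `<=` U),
    bijective (fun a : sec W => a *: mres WU e).

Definition line_bundle (X : ringed_space) (M : omodule X) : Prop :=
  forall x : X, exists (U : opens X) (e : msec M U), pts U x /\ generator e.

(* T is isomorphic to O(d): it has generators e i on chart i (playing the role
   of X_i ^ d) with e j = (X_j / X_i) ^ d e i on the overlaps. *)
Definition twist (k : fieldType) (N : nat) (P : scheme_over k)
    (X : proj_space N P) (d : int) (T : omodule P) : Prop :=
  exists e : forall i, msec T (chart X i), (forall i, generator (e i)) /\
    forall i j (W : opens P) (Wi : W `<=` chart X i) (Wj : W `<=` chart X j),
      mres Wj (e j) =
        (match d with
         | Posz m => res Wi (coord X i j) ^+ m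
         | Negz m => res Wj (coord X j i) ^+ m.+1
         end) *: mres Wi (e i).

(* An isomorphism from the direct sum of the T_p = O(- a p) to E, given by its
   restrictions to the summands, with a nondecreasing. *)
Record splitting (k : fieldType) (P : scheme_over k) (X : proj_space 1 P)
    (E : omodule P) (n : nat) (a : 'I_n -> int) := Splitting {
  summand : 'I_n -> omodule P;
  incl : forall p, omod_hom (summand p) E;
  summand_twist : forall p, twist X (- a p) (summand p);
  incl_iso : forall (V : opens P) (s : msec E V),
    exists! t : (forall p, msec (summand p) V), s = \sum_p incl p V (t p);
  splitting_sorted : forall p q : 'I_n, (p <= q)%N -> a p <= a q }.

(* S, with the germ maps, is a colimit of the O(U) over the open U containing x,
   that is, a model of the stalk of O_X at x. *)
Record stalk (X : ringed_space) (x : X) (S : comPzRingType) := Stalk {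
  germ : forall U : opens X, pts U x -> {rmorphism sec U -> S};
  germ_res : forall (U V : opens X) (VU : V `<=` U) (Ux : pts U x)
    (Vx : pts V x) (s : sec U), germ Vx (res VU s) = germ Ux s;
  germ_surj : forall z : S, exists (U : opens X) (Ux : pts U x) (s : sec U),
    germ Ux s = z;
  germ_eq : forall (U : opens X) (Ux : pts U x) (s t : sec U),
    germ Ux s = germ Ux t ->
    exists (V : opens X) (VU : V `<=` U), pts V x /\ res VU s = res VU t }.

Record mod_stalk (X : ringed_space) (x : X) (S : comPzRingType)
    (st : stalk x S) (M : omodule X) (N : lmodType S) := ModStalk {
  mgerm : forall U : opens X, pts U x -> msec M U -> N;
  mgerm_linear : forall (U : opens X) (Ux : pts U x) (a : sec U)
    (s t : msec M U),
    mgerm Ux (a *: s + t) = germ st Ux a *: mgerm Ux s + mgerm Ux t;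
  mgerm_res : forall (U V : opens X) (VU : V `<=` U) (Ux : pts U x)
    (Vx : pts V x) (s : msec M U), mgerm Vx (mres VU s) = mgerm Ux s;
  mgerm_surj : forall z : N, exists (U : opens X) (Ux : pts U x)
    (s : msec M U), mgerm Ux s = z;
  mgerm_eq : forall (U : opens X) (Ux : pts U x) (s t : msec M U),
    mgerm Ux s = mgerm Ux t ->
    exists (V : opens X) (VU : V `<=` U), pts V x /\ mres VU s = mres VU t }.

Section StructureStalk.
Variables (X : ringed_space) (x : X) (S : comPzRingType) (st : stalk x S).

Let sgerm (U : opens X) (Ux : pts U x) : msec (struct_sheaf X) U -> S^o :=
  germ st Ux.

Let sgerm_linear (U : opens X) (Ux : pts U x) (a : sec U)
    (s t : msec (struct_sheaf X) U) :
  sgerm Ux (a *: s + t) = germ st Ux a *: sgerm Ux s + sgerm Ux t.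
Proof. by rewrite /sgerm rmorphD rmorphM. Qed.

Definition struct_stalk : mod_stalk st (struct_sheaf X) S^o :=
  @ModStalk X x S st (struct_sheaf X) S^o sgerm sgerm_linear
    (@germ_res X x S st) (@germ_surj X x S st) (@germ_eq X x S st).
End StructureStalk.

(* The stalk of M at the point eta is identified with the field L through
   [st].  A section of the pushforward of M over V is a section of M over the
   preimage of V, and passing to germs identifies the stalk of the pushforward
   at nu with that of M at eta.  [filtration sp st nu i] is the preimage in L of
   the stalk at nu of the sum of the summands 0, ..., i of the splitting. *)
Definition filtration (k : fieldType) (C P : scheme_over k)
    (X : proj_space 1 P) (f : smor C P) (M : omodule C) (n : nat)
    (a : 'I_n -> int) (sp : splitting X (pushforward f M) a)
    (L : fieldType) (eta : C) (stL : stalk eta L) (st : mod_stalk stL M L^o)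
    (nu : P) (i : 'I_n) : set L :=
  [set z | exists (V : opens P) (Vnu : pts V nu) (Veta : pts (opre f V) eta)
             (t : forall p, msec (summand sp p) V),
     (forall p : 'I_n, (i < p)%N -> t p = 0) /\
     z = mgerm st Veta (\sum_p incl sp p V (t p))].

Definition set_mul (L : fieldType) (F G : set L) : set L :=
  [set x * y | x in F & y in G].

(* Main.v *)
(* On the generic fibre a splitting of the pushforward is a K-basis E_q of the
   function field L, and with x = X_1 / X_0 the sections over the two standard
   charts of the projective line are the combinations of the E_q with
   coefficients in k[x], resp. of the x^(-a_q) E_q with coefficients in k[1/x].
   Expanding a product of basis elements over both charts, the coefficient of
   the l-th basis element lies in k[x] and in x^e k[1/x] with
   e = a_p + b_q - b_l, so it vanishes when e < 0.  This bounds the flags and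
   gives the first part.

   If b_(i+j) > a_i + b_j, then F_i G_j lies in a space of dimension i + j,
   while dim F_i = i + 1 and dim G_j = j + 1.  Kneser's theorem for field
   extensions provides a field M of degree m with F_i G_j stable under M and
   dim F_i G_j >= dim M F_i + dim M G_j - m; as dim M F_i >= m (i/m + 1) and
   likewise for G_j, this is impossible unless i + j has a carry modulo m.

   L/K may be inseparable, so Kneser's theorem is proved by the isoperimetric
   method.  Fix S and put excess X = dim XS - dim X, a submodular function; call
   X saturated if it contains every y with yS in XS.  Starting from M = L, as
   long as some saturated space of excess at most l is not M-stable, take the
   least such excess and a saturated space N of that excess, inside M and
   containing 1, of minimal dimension.  Submodularity and the duality
   X |-> (XS)^perp show that all saturated spaces of that excess are N-stable;
   in particular N is a field, and it replaces M. *)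
Require Import Defs.
From HB Require Import structures.
From mathcomp Require Import all_boot all_order all_algebra all_field.
From mathcomp Require Import zify.
From mathcomp Require Import boolp classical_sets topology.
From mathcomp Require Import mpoly.

Set Implicit Arguments.
Unset Strict Implicit.
Unset Printing Implicit Defensive.

Import Order.TTheory GRing.Theory Num.Theory.
Local Open Scope classical_set_scope.
Local Open Scope ring_scope.

(** * Kneser's theorem for field extensions *)

Lemma leq_of_dvd (d b q : nat) :
  (d %| b -> d %| q -> b < d + q -> b <= q)%N.
Proof.
move=> /dvdnP[b' ->] /dvdnP[q' ->]; rewrite -mulSn ltn_mul2r leq_mul2r ltnS.
by case/andP=> _ ->; rewrite orbT.
Qed.

(** The left side is the least multiple of [m] above [i], and [d] is such a multiple. *)
Lemma leq_mul_divS (m d i : nat) : (m %| d -> i < d -> m * (i %/ m).+1 <= d)%N.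
Proof.
move=> /dvdnP[q ->] lt_i; rewrite mulnC leq_mul2r.
by case: m lt_i => // m lt_i; rewrite /= ltn_divLR.
Qed.

Lemma ex_min_nat (P : nat -> Prop) :
  (exists n, P n) -> exists2 n, P n & forall m, P m -> (n <= m)%N.
Proof.
move=> [n Pn]; have exP : exists n, (fun n => `[< P n >]) n by exists n; apply/asboolP.
by case: (ex_minnP exP) => m /asboolP Pm min; exists m => // p Pp; apply/min/asboolP.
Qed.

(** * Orthogonality for the bilinear form [lam (x * y)] *)

Section Orthogonal.
Variables (F : fieldType) (L : fieldExtType F) (lam : 'Hom(L, F^o)).
Implicit Types (A B : {vspace L}) (x y : L).

Definition perp_map B x : 'rV[F]_(\dim B) := \row_i lam (x * (vbasis B)`_i).

Fact perp_map_is_linear B : linear (perp_map B).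
Proof.
by move=> c x y; apply/rowP=> i; rewrite !mxE mulrDl -scalerAl linearP.
Qed.
HB.instance Definition _ B :=
  GRing.isLinear.Build F L 'rV[F]_(\dim B) _ (perp_map B) (perp_map_is_linear B).

Definition perp B : {vspace L} := lker (linfun (perp_map B)).

Lemma memv_perp B x :
  reflect (forall y, y \in B -> lam (x * y) = 0) (x \in perp B).
Proof.
rewrite memv_ker lfunE /=; apply: (iffP eqP) => [xB y /coord_vbasis -> | xB].
  rewrite mulr_sumr linear_sum big1 // => i _.
  have /rowP/(_ i) := xB; rewrite !mxE => xi.
  by rewrite -scalerAr linearZ /= xi scaler0.
by apply/rowP=> i; rewrite !mxE xB // vbasis_mem // mem_nth // size_tuple.
Qed.

Lemma perpS A B : (A <= B)%VS -> (perp B <= perp A)%VS.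
Proof.
move=> /subvP sAB; apply/subvP=> x /memv_perp xB; apply/memv_perp=> y /sAB.
exact: xB.
Qed.

Lemma sub_perp A B : (A <= perp B)%VS = (B <= perp A)%VS.
Proof.
by apply/idP/idP=> /subvP sAB; apply/subvP=> x xA; apply/memv_perp=> y /sAB
  /memv_perp/(_ _ xA); rewrite mulrC.
Qed.

Lemma dim_cap_perp A B : (\dim A <= \dim (A :&: perp B) + \dim B)%N.
Proof.
rewrite -(limg_ker_dim (linfun (perp_map B)) A) leq_add2l.
by have := dimvS (subvf (linfun (perp_map B) @: A)); rewrite dimvf dim_matrix mul1r.
Qed.

Hypothesis lam_neq0 : exists u, lam u != 0.

(** Nondegeneracy: the multiples of a nonzero [x] fill [L], so [lam] would vanish. *)
Lemma perp_fullv : perp {:L} = 0%VS.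
Proof.
apply/eqP; rewrite -subv0; apply/subvP=> x /memv_perp xL; rewrite memv0.
have [u] := lam_neq0; apply: contraR => x0.
by rewrite -(mulfVK x0 u) mulrC xL ?memvf.
Qed.

Lemma dim_perp B : (\dim (perp B) + \dim B = \dim {:L})%N.
Proof.
apply/eqP; rewrite eqn_leq; apply/andP; split; last first.
  by have := dim_cap_perp fullv B; rewrite capfv.
(* If [V] were too large, [V^C] would impose fewer than [\dim B] conditions on [B]; but a vector of
   [B] orthogonal to [V^C] is also orthogonal to [V], hence zero. *)
set V := perp B; rewrite leqNgt; apply/negP=> ltLV.
have := dim_cap_perp B V^C; rewrite dimv_compl.
have -> : (B :&: perp V^C = 0)%VS.
  apply/eqP; rewrite -subv0 -perp_fullv -(addv_complf V).
  apply/subvP=> x /memv_capP[xB /memv_perp xC].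
  apply/memv_perp=> _ /memv_addP[v vV [w wC ->]].
  move/memv_perp: vV => /(_ _ xB) vx.
  by rewrite mulrDr linearD /= mulrC vx xC // addr0.
have := dimvS (subvf V); rewrite dimv0; lia.
Qed.

Lemma perpK B : perp (perp B) = B.
Proof.
apply/esym/eqP; rewrite eqEdim sub_perp subvv /=.
have := dim_perp B; have := dim_perp (perp B); lia.
Qed.

End Orthogonal.

(** * Excess, duality and saturation relative to [S] *)

Section Boundary.
Variables (F : fieldType) (L : fieldExtType F) (lam : 'Hom(L, F^o)).
Hypothesis lam_neq0 : exists u, lam u != 0.
Variable S : {vspace L}.
Hypothesis S_neq0 : S != 0%VS.
Implicit Types (T X Y Z : {vspace L}) (M N : {subfield L}) (x y : L).

(** The truncated subtraction is exact: [X * S] contains a translate of [X], see [dim_excess]. *)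
Definition excess X : nat := (\dim (X * S) - \dim X)%N.
Ltac dlia := do ?move: (excess _); do ?move: (\dim _); clear; lia.

Definition dual X : {vspace L} := perp lam (X * S).
Definition saturated X : bool := dual (dual X) == X.
Definition stable (M : {vspace L}) X : bool := (M * X <= X)%VS.

Lemma dim_excess X : (\dim (X * S) = \dim X + excess X)%N.
Proof.
rewrite subnKC //; have s0 : vpick S != 0 by rewrite vpick0.
by rewrite -(dim_cosetv X s0) dimvS // prodvSr // -memvE memv_pick.
Qed.

Lemma excess_submod X Y : (excess (X :&: Y) + excess (X + Y) <= excess X + excess Y)%N.
Proof.
have := dimv_sum_cap X Y; have := dimv_sum_cap (X * S) (Y * S).
rewrite -prodvDl; have : (\dim ((X :&: Y) * S) <= \dim (X * S :&: Y * S))%N.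
  by rewrite dimvS // subv_cap !prodvSl ?capvSl ?capvSr.
rewrite !dim_excess; dlia.
Qed.

(** The double dual is thus the saturation of [X], and [saturated] is closure under it. *)
Lemma memv_bidual X y :
  reflect (forall s, s \in S -> y * s \in (X * S)%VS) (y \in dual (dual X)).
Proof.
apply: (iffP (memv_perp _ _ _)) => [yX s sS | yX z].
  rewrite -[(X * S)%VS](perpK lam_neq0); apply/memv_perp=> z zX.
  by rewrite -mulrA [s * z]mulrC yX // memv_mul.
move: z; apply/(@memv_perp _ _ lam (dual X * S)%VS y).
suff : (dual X * S <= perp lam <[y]>)%VS by rewrite sub_perp -memvE.
apply/prodvP=> z s zX sS; rewrite memvE -sub_perp -memvE; apply/memv_perp=> w.
case/vlineP=> c ->.
rewrite -scalerAr linearZ /= mulrCA.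
by move/memv_perp: zX => -> //; rewrite ?scaler0 ?yX.
Qed.

Lemma sub_bidual X : (X <= dual (dual X))%VS.
Proof. by apply/subvP=> x xX; apply/memv_bidual=> s sS; apply: memv_mul. Qed.

Lemma bidual_mulS X : (dual (dual X) * S = X * S)%VS.
Proof.
apply/eqP; rewrite eqEsubv; apply/andP; split; last exact: prodvSl (sub_bidual _).
by apply/prodvP=> y s /memv_bidual yX /yX.
Qed.

Lemma saturated_dual X : saturated (dual X).
Proof. by rewrite /saturated {1}/dual bidual_mulS. Qed.

Lemma saturated_bidual X : saturated (dual (dual X)).
Proof. exact: saturated_dual. Qed.

Lemma excess_bidual X : (excess (dual (dual X)) <= excess X)%N.
Proof. by rewrite /excess bidual_mulS leq_sub2l // dimvS // sub_bidual. Qed.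

Lemma saturatedP X :
  reflect (forall y, (forall s, s \in S -> y * s \in (X * S)%VS) -> y \in X)
    (saturated X).
Proof.
apply: (iffP eqP) => [<- y yX | satX].
  by apply/memv_bidual=> s /yX; rewrite bidual_mulS.
apply/eqP; rewrite eqEsubv sub_bidual andbT.
by apply/subvP=> y /memv_bidual /satX.
Qed.

Lemma saturated_cap X Y : saturated X -> saturated Y -> saturated (X :&: Y).
Proof.
move=> /saturatedP sX /saturatedP sY; apply/saturatedP=> y yXY; rewrite memv_cap.
by rewrite sX ?sY // => s /yXY; apply/subvP; rewrite prodvSl ?capvSl ?capvSr.
Qed.

Lemma dim_dual X : (\dim (dual X) + \dim (X * S) = \dim {:L})%N.
Proof. exact: dim_perp. Qed.

Lemma dim_dual_mulS X : saturated X -> (\dim (dual X * S) + \dim X = \dim {:L})%N.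
Proof. by move/eqP=> {2}<-; rewrite -(dim_dual (dual X)) addnC. Qed.

(** Up to complement in [\dim {:L}], duality exchanges [\dim X] and [\dim (X * S)]. *)
Lemma excess_dual X : saturated X -> excess (dual X) = excess X.
Proof.
by move=> sX; have := dim_dual X; have := dim_dual_mulS sX; rewrite !dim_excess; dlia.
Qed.

Lemma stable_mul T X : stable T X -> stable T (X * S).
Proof. by rewrite /stable prodvA => TX; apply: prodvSl. Qed.

(** Multiplication by an element of [T] is self-adjoint for the form. *)
Lemma stable_dual T X : stable T X -> stable T (dual X).
Proof.
move/stable_mul=> /prodvP TX; apply/prodvP=> a x aT /memv_perp xX.
apply/memv_perp=> y yX; rewrite mulrAC [_ * x]mulrC xX // TX //.
Qed.

Lemma stable_dualE T X : saturated X -> stable T (dual X) = stable T X.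
Proof.
by move/eqP=> sX; apply/idP/idP; last exact: stable_dual; rewrite -{2}sX;
  exact: stable_dual.
Qed.

Lemma stable_dvd M X : stable M X -> (\dim M %| \dim X)%N.
Proof. exact: field_module_dimS. Qed.

Lemma stable_sub T1 T2 X : (T1 <= T2)%VS -> stable T2 X -> stable T1 X.
Proof. by move=> T12; apply: subv_trans; apply: prodvSl. Qed.

Lemma not_stableP T X :
  reflect (exists2 x, x \in X & ~~ (T * <[x]> <= X)%VS) (~~ stable T X).
Proof.
apply: (iffP idP) => [|[x xX]]; last first.
  by apply: contra; apply: subv_trans; rewrite prodvSr // -memvE.
move=> /subvPn[y yTX yX]; apply: contrapT => nex; move/negP: yX; apply.
suff /prodvP : forall a x, a \in T -> x \in X -> a * x \in X by move/subvP; apply.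
move=> a x aT xX; apply: contrapT => /negP axX; apply: nex; exists x => //.
apply: contra axX => /subvP; apply; apply: memv_mul => //; exact: memv_line.
Qed.

Section Coset.
Variable x : L.
Hypothesis x0 : x != 0.

Lemma coset_mulS X : (X * <[x]> * S = X * S * <[x]>)%VS.
Proof. by rewrite -!prodvA [(<[x]> * S)%VS]prodvC. Qed.

Lemma excess_coset X : excess (X * <[x]>) = excess X.
Proof. by rewrite /excess coset_mulS !dim_cosetv. Qed.

Lemma memv_coset X y : (y \in X * <[x]>)%VS = (y / x \in X).
Proof.
apply/memv_cosetP/idP => [[z zX ->]|yX]; first by rewrite mulfK.
by exists (y / x) => //; rewrite divfK.
Qed.

Lemma saturated_coset X : saturated X -> saturated (X * <[x]>).
Proof.
move=> /saturatedP sX; apply/saturatedP=> y yX; rewrite memv_coset sX // => s /yX.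
by rewrite coset_mulS memv_coset mulrAC.
Qed.

Lemma stable_coset T X : stable T (X * <[x]>) = stable T X.
Proof.
apply/idP/idP=> [/prodvP TX|]; last by rewrite /stable prodvA => TX; apply: prodvSl.
apply/prodvP=> a z aT zX; have := TX a (z * x) aT.
by rewrite !memv_coset mulrA !mulfK //; apply.
Qed.

End Coset.

(** * Descent through subfields *)

Lemma sub_dual X Y : (X <= Y)%VS -> (dual Y <= dual X)%VS.
Proof. by move=> XY; apply: perpS; apply: prodvSl. Qed.

Lemma dim_mulS_cap X Y :
  (\dim ((X + Y) * S) + \dim ((X :&: Y) * S) <= \dim (X * S) + \dim (Y * S))%N.
Proof.
rewrite -(dimv_sum_cap (X * S)) prodvDl leq_add2l dimvS //.
by rewrite subv_cap !prodvSl ?capvSl ?capvSr.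
Qed.

Lemma coset_sub_neq0 T X x : ~~ (T * <[x]> <= X)%VS -> x != 0.
Proof.
by apply: contraNneq => ->; rewrite (_ : <[0]> = 0)%VS ?prodv0 ?sub0v.
Qed.

Lemma memv_cap_coset M X x : x \in X -> x \in (X :&: M * <[x]>)%VS.
Proof.
move=> xX; rewrite memv_cap xX -[x in x \in _]mul1r memv_mul ?mem1v //.
exact: memv_line.
Qed.

Lemma cap_not_stable T X Y x :
  x \in (X :&: Y)%VS -> ~~ (T * <[x]> <= X)%VS -> ~~ stable T (X :&: Y).
Proof.
move=> xXY TxX; apply/not_stableP; exists x => //; apply: contra TxX => sub.
exact: subv_trans sub (capvSl _ _).
Qed.

(** The intersection of [X] with [M x] contains [x] but not [M x], so it is not [M]-stable and its
    excess, not being [l], exceeds [l]. Submodularity pushes the excess of [X + M x] below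
    [excess M]; [W] is the saturation of this sum. *)
Lemma coset_growth M T X x l :
    saturated M -> saturated X -> excess X = l -> x \in X -> ~~ (M * <[x]> <= X)%VS ->
    (forall Z, saturated Z -> excess Z < l -> stable M Z)%N ->
    (forall Z, saturated Z -> excess Z < excess M -> stable T Z)%N ->
    excess (X :&: M * <[x]>) <> l ->
  exists W, [/\ stable T W, saturated W, (X <= W)%VS
    & (\dim (W * S) + l + 2 <= \dim (X * S) + excess M + \dim M)%N].
Proof.
move=> sM sX bX xX MxX stM stT neZ.
have x0 := coset_sub_neq0 MxX; set Z := (X :&: _)%VS in neZ.
have sZ : saturated Z by rewrite saturated_cap ?saturated_coset.
have xZ : x \in Z by apply: memv_cap_coset.
have nZ : ~~ stable M Z by apply: cap_not_stable MxX.
have ltlZ : (l < excess Z)%N.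
  by rewrite ltn_neqAle leqNgt (contra (stM _ sZ)) // andbT eq_sym; apply/eqP.
have Z0 : (0 < \dim Z)%N.
  by rewrite lt0n dimv_eq0; apply: contraTneq xZ => ->; rewrite memv0.
set W := (X + M * <[x]>)%VS.
have bW : (excess W < excess M)%N.
  by have := excess_submod X (M * <[x]>); rewrite excess_coset // bX -/Z -/W; lia.
exists (dual (dual W)); split; rewrite ?saturated_bidual ?bidual_mulS //.
- by apply: stT; rewrite ?saturated_bidual // (leq_ltn_trans (excess_bidual _)).
- exact: subv_trans (addvSl _ _) (sub_bidual W).
(* The 2 arises because [Z] has dimension at least 1 and excess at least [l + 1]. *)
have := dim_mulS_cap X (M * <[x]>); rewrite -/Z -/W !dim_excess.
rewrite excess_coset // dim_cosetv //.
move: ltlZ Z0; dlia.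
Qed.

(* Otherwise let W and W' be the saturations of X + Mx and dual X + My, both
   M2-stable.  Then dim M2 divides q = dim WS - dim (dual W'), although q lies
   strictly between the consecutive multiples dim M2 S - dim M2 = excess M2 and
   dim M2 S of dim M2. *)
Lemma cap_coset_dichotomy M M2 X x y l :
    saturated M -> (M <= M2)%VS -> ~~ (M2 <= M)%VS -> (excess M2 <= excess M < l)%N ->
    saturated X -> excess X = l ->
    (forall Z, saturated Z -> excess Z < l -> stable M Z)%N ->
    (forall Z, saturated Z -> excess Z < excess M -> stable M2 Z)%N ->
    x \in X -> ~~ (M * <[x]> <= X)%VS ->
    y \in dual X -> ~~ (M * <[y]> <= dual X)%VS ->
  excess (X :&: M * <[x]>) = l \/ excess (dual X :&: M * <[y]>) = l.
Proof.
move=> sM MM2 nM2M /andP[bM2 bM] sX bX stM stM2 xX MxX yX MyX.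
have [->|/eqP/(coset_growth sM sX bX xX MxX stM stM2)] :=
  eqVneq (excess (X :&: M * <[x]>)) l.
  by left.
case=> W [tW sW XW dW].
have [->|/eqP/(coset_growth sM (saturated_dual X) _ yX MyX stM stM2)] :=
  eqVneq (excess (dual X :&: M * <[y]>)) l; first by right.
case=> [|W' [tW' sW' XW' dW']]; first by rewrite excess_dual.
exfalso.
have MSM2S : (M * S <= M2 * S)%VS by apply: prodvSl.
(* If [M2 * S = M * S], saturation of [M] would put [M2] inside [M]. *)
have ltMS : (\dim (M * S) < \dim (M2 * S))%N.
  rewrite ltn_neqAle dimvS // andbT; apply: contra nM2M => eqd.
  have /eqP eqMS : (M * S == M2 * S)%VS by rewrite eqEdim MSM2S (eqP eqd) leqnn.
  by apply/subvP=> z zM2; move/saturatedP: sM; apply=> s sS; rewrite eqMS memv_mul.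
have stMM : stable M (M * S) by rewrite /stable prodvA prodv_id.
have stM2M2 : stable M2 (M2 * S) by rewrite /stable prodvA prodv_id.
have dvM : (\dim M %| \dim (M * S))%N by exact: stable_dvd stMM.
have dvM2 : (\dim M %| \dim (M2 * S))%N.
  exact: stable_dvd (stable_sub MM2 stM2M2).
have dvq : (\dim M2 %| \dim (W * S) - \dim (dual W'))%N.
  by rewrite dvdn_sub //; apply: stable_dvd; rewrite ?stable_mul ?stable_dual.
have M2S := stable_dvd stM2M2.
have sXX := dim_dual_mulS sX.
have W'X : (dual W' <= X)%VS by rewrite -(eqP sX) sub_dual.
have h1 := dimvS W'X; have h2 := dim_dual W'.
have h3 : (\dim (X * S) <= \dim (W * S))%N by rewrite dimvS // prodvSl.
have h5 : (\dim (M * S) + \dim M <= \dim (M2 * S))%N.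
  apply: (@leq_of_dvd (\dim M)); rewrite ?dvdn_addl //.
  by rewrite addnC ltn_add2l.
have hq : (\dim (W * S) - \dim (dual W') + \dim (dual W') = \dim (W * S))%N.
  by rewrite subnK // (leq_trans h1) // (leq_trans _ h3) // dim_excess leq_addr.
move: M2S dvq dW dW' h1 h2 h3 h5 hq sXX; rewrite !dim_excess bX.
move: (subn _ _) => q M2S dvq dW dW' h1 h2 h3 h5 hq sXX.
have h4 : (\dim M2 + excess M2 <= q)%N.
  by apply: (leq_of_dvd M2S dvq); rewrite ltn_add2l; move: h1 h3 hq bM bM2; dlia.
by move: h4 dW dW' h1 h2 h5 hq sXX bM; dlia.
Qed.

(* M2 is the field preceding M in the descent; its larger stability range is
   what makes [cap_coset_dichotomy] work. *)
Definition stabilizer_chain M : Prop :=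
  saturated M /\ (M = fullv :> {vspace L} \/ exists M2 : {subfield L},
    [/\ (M <= M2)%VS, ~~ (M2 <= M)%VS, (excess M2 <= excess M)%N,
        forall X, saturated X -> (excess X < excess M)%N -> stable M2 X
      & forall X, saturated X -> (excess X <= excess M)%N -> stable M X]).

(** Division by [x] moves the intersection into [M] and makes it contain 1. *)
Lemma translate_cap M T X x l :
    (T <= M)%VS -> saturated M -> saturated X -> x \in X -> ~~ (T * <[x]> <= X)%VS ->
    excess (X :&: M * <[x]>) = l ->
  exists Y, [/\ saturated Y, excess Y = l, ~~ stable T Y, (Y <= M)%VS & 1 \in Y].
Proof.
move=> TM sM sX xX TxX bX; have x0 := coset_sub_neq0 TxX.
have x'0 : x^-1 != 0 by rewrite invr_eq0.
exists ((X :&: M * <[x]>) * <[x^-1]>)%VS; split.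
- by rewrite saturated_coset ?saturated_cap ?saturated_coset.
- by rewrite excess_coset.
- by rewrite stable_coset //; apply: cap_not_stable TxX; apply: memv_cap_coset.
- apply: subv_trans (prodvSl _ (capvSr _ _)) _.
  by rewrite -prodvA prodv_line mulfV // prodv1.
- by rewrite memv_coset // div1r invrK memv_cap_coset.
Qed.

(** For [M = L] the intersection with [M x] is [X] itself. Otherwise the dichotomy preserves the
    excess of an intersection taken in [X] or in [dual X], and that one is translated. *)
Lemma unstable_in_subfield M T X l :
    stabilizer_chain M ->
    (forall Z, saturated Z -> excess Z < l -> stable M Z)%N -> (T <= M)%VS ->
    saturated X -> excess X = l -> ~~ stable T X ->
  exists Y, [/\ saturated Y, excess Y = l, ~~ stable T Y, (Y <= M)%VS & 1 \in Y].
Proof.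
move=> [sM invM] stM TM sX bX nTX; have /not_stableP[x xX TxX] := nTX.
have Mx z Y : ~~ (T * <[z]> <= Y)%VS -> ~~ (M * <[z]> <= Y)%VS.
  by apply: contra; apply: subv_trans; apply: prodvSl.
case: invM => [Mfull | [M2 [MM2 nM2M bM2 stM2 stMle]]].
  apply: (translate_cap TM sM sX xX TxX); rewrite -bX; congr excess.
  apply/capv_idPl; apply: subv_trans (subvf _) _.
  by rewrite Mfull; apply/subvP=> z _; rewrite memv_coset ?memvf // (coset_sub_neq0 TxX).
(* If [l <= excess M], then [M], hence [T], would stabilize [X]. *)
have bM : (excess M2 <= excess M < l)%N.
  rewrite bM2 ltnNge /=; apply: contra nTX => lM.
  by apply: (stable_sub TM); apply: stMle; rewrite ?bX.
have /not_stableP[y yX TyX] : ~~ stable T (dual X) by rewrite stable_dualE.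
have [bXx | bXy] :=
  cap_coset_dichotomy sM MM2 nM2M bM sX bX stM stM2 xX (Mx _ _ TxX) yX (Mx _ _ TyX).
- exact: (translate_cap TM sM sX xX TxX bXx).
- exact: (translate_cap TM sM (saturated_dual X) yX TyX bXy).
Qed.

(** An [N]-unstable [X] yields a [Y] inside [M], no smaller than [N]. The intersection [Z] of
    [dual Y] with a translate of [N] has excess above [l], so their sum [W] has excess below [l].
    This forces [dual W = 0], and a dimension count concludes. *)
Lemma min_cell_stable M (N X : {vspace L}) l :
    stabilizer_chain M ->
    (forall Z, saturated Z -> excess Z < l -> stable M Z)%N ->
    saturated N -> excess N = l -> ~~ stable M N -> (N <= M)%VS ->
    1 \in N ->
    (forall Y, saturated Y -> excess Y = l -> ~~ stable M Y -> (Y <= M)%VS -> 1 \in Y ->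
       (\dim N <= \dim Y)%N) ->
  saturated X -> excess X = l -> stable N X.
Proof.
move=> invM stM sN bN nN NM N1 minN sX bX; apply: contrapT => /negP nX.
have [Y [sY bY nY YM Y1]] := unstable_in_subfield invM stM NM sX bX nX.
have nMY : ~~ stable M Y by apply: contra nY; apply: stable_sub.
have NY := minN _ sY bY nMY YM Y1.
have /not_stableP[y yY NyY] : ~~ stable N (dual Y) by rewrite stable_dualE.
have y0 := coset_sub_neq0 NyY; have y'0 : y^-1 != 0 by rewrite invr_eq0.
have ltNM : (\dim N < \dim M)%N.
  rewrite ltn_neqAle dimvS // andbT; apply: contra nN => /eqP eqd.
  have -> : N = M by apply/eqP; rewrite eqEdim NM eqd leqnn.
  exact: asubv.
set Z := (dual Y :&: N * <[y]>)%VS.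
have sZ : saturated Z by rewrite saturated_cap ?saturated_dual ?saturated_coset.
have yZ : y \in Z by rewrite memv_cap yY memv_coset // divff.
have ltZN : (\dim Z < \dim N)%N.
  rewrite -(dim_cosetv N y0) ltn_neqAle dimvS ?capvSr // andbT.
  apply: contra NyY => /eqP eqd; suff <- : Z = (N * <[y]>)%VS by apply: capvSl.
  by apply/eqP; rewrite eqEdim capvSr eqd leqnn.
have nZ : ~~ stable M Z.
  apply/negP=> MZ; have : (\dim M <= \dim Z)%N.
    rewrite -(dim_cosetv M y0) dimvS //; apply: subv_trans MZ.
    by rewrite prodvSr // -memvE.
  by rewrite leqNgt (ltn_trans ltZN).
have ltlZ : (l < excess Z)%N.
  rewrite ltn_neqAle leqNgt (contra (stM _ sZ)) // andbT eq_sym.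
  (* With excess [l], the translate of [Z] by [y^-1] would be a smaller competitor of [N]. *)
  apply/eqP=> bZ; suff : false by []; have := minN (Z * <[y^-1]>)%VS.
  rewrite saturated_coset // excess_coset // stable_coset // dim_cosetv // leqNgt ltZN /=.
  move=> /(_ isT bZ nZ); apply.
    apply: subv_trans (prodvSl _ (capvSr _ _)) _.
    by rewrite -prodvA prodv_line mulfV // prodv1.
  by rewrite memv_coset // div1r invrK.
set W := (dual Y + N * <[y]>)%VS.
have bW : (excess W < l)%N.
  have := excess_submod (dual Y) (N * <[y]>).
  by rewrite (excess_coset y0) (excess_dual sY) bY bN -/Z -/W; move: ltlZ; dlia.
have MW : stable M (dual W).
  rewrite -stable_dualE ?saturated_dual //; apply: stM; rewrite ?saturated_bidual //.
  exact: leq_ltn_trans (excess_bidual _) bW.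
have WY : (dual W <= Y)%VS by rewrite -(eqP sY) sub_dual ?addvSl.
(* A nonzero [w] in the [M]-stable space [dual W] would give [M w] inside [Y], hence [Y = M], which
   is [M]-stable. *)
have W0 : dual W = 0%VS.
  apply/eqP; apply: contraNT nMY; rewrite -vpick0 => w0.
  have wW := memv_pick (dual W).
  have -> : Y = M; last exact: asubv.
  apply/eqP; rewrite eqEdim YM -(dim_cosetv M w0) dimvS //.
  by apply: subv_trans WY; apply: subv_trans MW; rewrite prodvSr // -memvE.
(* Since [W * S] is all of [L], [\dim Y + \dim (Z * S) <= \dim N + l], against [\dim N <= \dim Y]
   and [l < excess Z]. *)
have h1 := dim_dual W; have h2 := dim_dual_mulS sY.
have := dim_mulS_cap (dual Y) (N * <[y]>); rewrite -/Z -/W.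
rewrite W0 dimv0 add0n in h1; rewrite h1 -h2 [\dim (Z * S)]dim_excess.
rewrite [\dim (N * _ * S)]dim_excess excess_coset // dim_cosetv // bN.
move: NY ltlZ; dlia.
Qed.

(** [N] has least dimension among the [M]-unstable saturated spaces of excess [l] inside [M] that
    contain 1. Applying [min_cell_stable] to [N] itself gives closure under products, so [N] is a
    field. *)
Lemma descent M l :
    stabilizer_chain M ->
    (forall Z, saturated Z -> excess Z < l -> stable M Z)%N ->
    (exists X, [/\ saturated X, excess X = l & ~~ stable M X]) ->
  exists N : {subfield L}, [/\ stabilizer_chain N, excess N = l & (\dim N < \dim M)%N].
Proof.
move=> invM stM [X0 [sX0 bX0 nX0]].
pose P d := exists Y, [/\ saturated Y, excess Y = l, ~~ stable M Y, (Y <= M)%VS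
  & 1 \in Y /\ \dim Y = d].
have [|d [N [sN bN nN NM [N1 dN]]] minN] := @ex_min_nat P.
  have [Y [sY bY nY YM Y1]] := unstable_in_subfield invM stM (subvv M) sX0 bX0 nX0.
  by exists (\dim Y), Y.
have stN X : saturated X -> excess X = l -> stable N X.
  apply: (min_cell_stable invM stM sN bN nN NM N1) => Y sY bY nY YM Y1.
  by rewrite dN; apply: minN; exists Y.
have aN : is_aspace N by rewrite /is_aspace has_algid1 //; apply: stN.
exists (ASpace aN); split => //=.
  split=> //; right; exists M; split=> //.
  - apply: contra nN => MN; rewrite /stable (subv_trans (prodvSr _ NM)) //.
    by rewrite (subv_trans (asubv _)).
  (* [excess M <= l]: the excess of [L] is 0, and for a proper [M] a smaller [l] would make [X0]
     stable. *)
  - have [sM [->|]] := invM.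
      rewrite /excess (_ : \dim (fullv * S) - _ = 0)%N //.
      by apply/eqP; rewrite subn_eq0 dimvS ?subvf.
    case=> M2 [_ _ _ _ stMle]; rewrite bN leqNgt; apply: contra nX0 => lM.
    by apply: stMle; rewrite ?bX0 // ltnW.
  - by rewrite bN; apply: stM.
  - move=> X sX; rewrite bN leq_eqVlt => /orP[/eqP/(stN _ sX)//|lX].
    exact: stable_sub NM (stM _ sX lX).
rewrite ltn_neqAle dimvS // andbT; apply: contra nN => /eqP eqd.
have -> : N = M by apply/eqP; rewrite eqEdim NM eqd leqnn.
exact: asubv.
Qed.

(** [descent] is iterated from [L], each time at the least excess of an unstable saturated space; it
    stops because [\dim M] drops. *)
Lemma common_stabilizer l : exists M : {subfield L},
  (excess M <= l)%N /\ forall X, saturated X -> (excess X <= l)%N -> stable M X.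
Proof.
have bf : excess {:L} = 0%N by apply/eqP; rewrite subn_eq0 dimvS ?subvf.
have invf : stabilizer_chain {:L}%AS.
  split; last by left.
  by apply/saturatedP=> y _; rewrite memvf.
suff H d (M : {subfield L}) : (\dim M <= d)%N ->
    stabilizer_chain M -> (excess M <= l)%N ->
    exists M : {subfield L},
      (excess M <= l)%N /\ forall X, saturated X -> (excess X <= l)%N -> stable M X.
  by apply: (H _ {:L}%AS (leqnn _) invf); rewrite bf.
elim: d M => [|d IHd] M dM invM bM.
  by have := adim_gt0 M; rewrite ltnNge dM.
pose P b := (b <= l)%N /\ exists X, [/\ saturated X, excess X = b & ~~ stable M X].
have [exP | nP] := pselect (exists b, P b); last first.
  exists M; split=> // X sX bX; apply: contrapT => /negP nX.
  by apply: nP; exists (excess X); split=> //; exists X.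
have [b [lb exX] minb] := ex_min_nat exP.
have stM Z : saturated Z -> (excess Z < b)%N -> stable M Z.
  move=> sZ bZ; apply: contrapT => /negP nZ.
  suff /minb : P (excess Z) by rewrite leqNgt bZ.
  by split; [rewrite (leq_trans (ltnW bZ)) | exists Z].
have [N [invN bN ltNM]] := descent invM stM exX.
by apply: IHd (N) _ invN _; rewrite ?bN // -ltnS (leq_trans ltNM).
Qed.

End Boundary.

(** With [X] the saturation of [T] and [M] the common stabilizer up to [excess X], [M * T] lies in
    [X] and [\dim (M * S)] is at most [\dim M + excess X]; the sum of the bounds is the claim. *)
Theorem linear_kneser (F : fieldType) (L : fieldExtType F) (S T : {vspace L}) :
    S != 0%VS ->
  exists M : {subfield L}, (M * (T * S) <= T * S)%VS /\
    (\dim (M * T) + \dim (M * S) <= \dim (T * S) + \dim M)%N.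
Proof.
move=> S0.
(* A coordinate form is nonzero for every extension, while the trace vanishes on inseparable
   ones. *)
have [lam lam0] : exists lam : 'Hom(L, F^o), exists u, lam u != 0.
  have L0 : (0 < \dim {:L})%N by apply: adim_gt0.
  exists (linfun (coord (vbasis {:L}) (Ordinal L0) : L -> F^o)).
  exists (vbasis {:L})`_(Ordinal L0); rewrite lfunE /=.
  by rewrite (coord_free (Ordinal L0) (Ordinal L0)) ?eqxx ?oner_neq0 //
    (basis_free (vbasisP _)).
pose X := dual lam S (dual lam S T).
have XS : (X * S = T * S)%VS by apply: bidual_mulS.
have sX : saturated lam S X by apply: saturated_bidual.
have [M [bM stM]] := common_stabilizer lam0 S0 (excess S X).
have MX := stM X sX (leqnn _).
exists M; split; first by rewrite -XS; apply: stable_mul.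
have : (\dim (M * T) <= \dim X)%N.
  by rewrite dimvS // (subv_trans _ MX) // prodvSr // sub_bidual.
rewrite -XS; have := dim_excess S0 X; have := dim_excess S0 M; move: bM.
do ?move: (excess _ _); do ?move: (\dim _); lia.
Qed.



Lemma carry_subfield (F : fieldType) (L : fieldExtType F) (S T : {vspace L}) (i j : nat) :
    \dim S = i.+1 -> \dim T = j.+1 -> (i + j < \dim {:L})%N ->
    (\dim (S * T) <= i + j)%N ->
  exists m : nat, [/\ (1 < m < \dim {:L})%N, exists E : {subfield L}, \dim E = m
    & (i %% m + j %% m)%N <> ((i + j) %% m)%N].
Proof.
move=> dS dT ijn dST; have T0 : T != 0%VS by rewrite -dimv_eq0 dT.
have [M [stM kneser]] := linear_kneser S T0.
have dvM (X : {vspace L}) : (\dim M %| \dim (M * X))%N.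
  by apply: field_module_dimS; rewrite prodvA prodv_id.
have geM (X : {vspace L}) : (\dim X <= \dim (M * X))%N.
  by rewrite dimvS // -{1}[X]prod1v prodvSl // sub1v.
(* Without a carry, rounding both dimensions up to multiples of [m = \dim M] gives [\dim (S * T) >=
   m (i/m + j/m + 1) > i + j]. *)
have carry : (i %% \dim M + j %% \dim M)%N <> ((i + j) %% \dim M)%N.
  have hS : (\dim M * (i %/ \dim M).+1 <= \dim (M * S))%N.
    by rewrite leq_mul_divS // -dS.
  have hT : (\dim M * (j %/ \dim M).+1 <= \dim (M * T))%N.
    by rewrite leq_mul_divS // -dT.
  have M0 := adim_gt0 M.
  have := ltn_pmod (i + j) M0 => lt1 eqm.
  have := divn_eq i (\dim M); have := divn_eq j (\dim M).
  move: kneser hS hT dST lt1 eqm; rewrite !mulnS.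
  have := mulnC (i %/ \dim M)%N (\dim M); have := mulnC (j %/ \dim M)%N (\dim M).
  do ?move: (_ %/ _)%N; do ?move: (_ %% _)%N; do ?move: (\dim _); clear; lia.
exists (\dim M); split => //; last by exists M.
(* No carry occurs modulo 1, nor modulo [\dim {:L}], which exceeds [i + j]. *)
have nM : (\dim M != 1)%N by apply/eqP=> d1; apply: carry; rewrite d1 !modn1.
rewrite ltn_neqAle eq_sym nM adim_gt0 ltn_neqAle dimvS ?subvf // !andbT /=.
apply/eqP=> dM; apply: carry; rewrite dM !modn_small //.
  exact: leq_ltn_trans (leq_addl _ _) ijn.
exact: leq_ltn_trans (leq_addr _ _) ijn.
Qed.

(** * Sections over integral schemes *)

Section IdentityMorphism.
Variable X : scheme.

Let idX_cont : continuous (@idfun X). Proof. by move=> x; exact: cvg_id. Qed.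

Let idX_pull (V : opens X) : {rmorphism sec V -> sec (opreim idX_cont V)} :=
  @res X V (opreim idX_cont V) (fun x Vx => Vx).

Let idX_pull_res (V W : opens X) (WV : W `<=` V)
    (fWV : opreim idX_cont W `<=` opreim idX_cont V) (s : sec V) :
  idX_pull W (res WV s) = res fWV (idX_pull V s).
Proof.
have WV' : opreim idX_cont W `<=` V by exact: WV.
by rewrite /idX_pull !(res_comp _ _ WV').
Qed.

Let idX_pull_local (V : opens X) (s : sec V) (x : X) :
  unit_at (idX_pull V s) x -> unit_at s x.
Proof.
move=> [U [UV [Ux [t st]]]]; have UV' : U `<=` V by exact: UV.
by exists U, UV'; split=> //; exists t; rewrite -st /idX_pull res_comp.
Qed.

Definition id_smor : smor X X := Smor idX_pull_res idX_pull_local.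

End IdentityMorphism.

(** The trivial base change, at which geometric integrality specializes to integrality. *)
Lemma id_base_change (k : fieldType) (X : scheme_over k) :
  base_change (idfun : {rmorphism k -> k}) (id_smor X).
Proof.
split=> [V c | T q qk].
  by rewrite /scal /=; apply: res_comp.
exists q; split=> //; first split=> // V s U Ur Uq.
  rewrite /=.
  have qV : opre q (opre (id_smor X) V) `<=` opre q V by [].
  rewrite (@pull_res _ _ q _ _ _ qV).
  exact: res_comp.
move=> r rk [rq rpull]; split=> [x|V s U Uq Ur]; first by rewrite -(rq x).
have Ur' : U `<=` opre r (opre (id_smor X) V) by exact: Ur.
rewrite -(rpull V s U Ur' Uq) /=.
have rV : opre r (opre (id_smor X) V) `<=` opre r V by [].
by rewrite (@pull_res _ _ r _ _ _ rV) (res_comp _ _ Ur).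
Qed.

Lemma geometrically_integral_integral (k : fieldType) (X : scheme_over k) :
  geometrically_integral X -> integral X.
Proof. by move=> geomX; exact: geomX (id_base_change X). Qed.

Lemma generic_point_open (X : scheme) (x y : X) (U : opens X) :
  generic_point x -> pts U y -> pts U x.
Proof.
move=> genx Uy; have : closure [set x] y by rewrite genx.
have nU : nbhs y (pts U) by apply: open_nbhs_nbhs; split=> //; apply: pts_open.
by move=> /(_ _ nU)[z [-> ]].
Qed.

Lemma sec_empty (X : ringed_space) (U : opens X) :
  (forall x, ~ pts U x) -> forall s t : sec U, s = t.
Proof.
move=> U0 s t; pose W (i : False) : opens X := match i with end.
have WU i : W i `<=` U by case: i.
by apply: (@sec_sep X False U W WU) => [x /U0 //|[]].
Qed.

Lemma msec_empty (X : ringed_space) (M : omodule X) (U : opens X) :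
  (forall x, ~ pts U x) -> forall s t : msec M U, s = t.
Proof.
move=> U0 s t; pose W (i : False) : opens X := match i with end.
have WU i : W i `<=` U by case: i.
by apply: (@msec_sep X M False U W WU) => [x /U0 //|[]].
Qed.

Lemma sec_nontrivial (X : scheme) (U : opens X) (x : X) :
  pts U x -> (1 : sec U) <> 0.
Proof. by case/(@scheme_local X). Qed.

Lemma unit_at_neq0 (X : scheme) (U : opens X) (x : X) : ~ unit_at (0 : sec U) x.
Proof.
by case=> V [VU [Vx [t]]]; rewrite rmorph0 mul0r => /esym /(sec_nontrivial Vx).
Qed.

(** On a basic open [D h] inside [V], vanishing means [h ^+ m * s = 0], with [h] nonzero in a
    domain. *)
Lemma affine_res_inj (X : scheme) (A V : opens X) (x : X) (s : sec A)
    (VA : V `<=` A) :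
  affine A -> integral_domain (sec A) -> pts V x -> res VA s = 0 -> s = 0.
Proof.
case=> _ bas _ loc [_ dom] Vx sV; have [h [hx hV]] := bas V x VA Vx.
have [m] : exists m : nat, h ^+ m * s = 0.
  by apply: loc; rewrite -(res_comp VA hV) sV rmorph0.
have h0 : h <> 0 by move=> h0; apply: (@unit_at_neq0 X A x); rewrite -h0.
elim: m => [|m IHm]; first by rewrite expr0 mul1r.
by rewrite exprS -mulrA => /dom[//|]; apply: IHm.
Qed.

Section Integral.
Variables (X : scheme) (intX : integral X) (eta : X).
Hypothesis genX : generic_point eta.

(** An affine [A] around a point need not lie in [U], so on a basic open in both the section is a
    fraction with numerator [a] on [A]. This [a] vanishes on an open set containing [eta], hence is
    zero. *)
Lemma res_generic_inj (U V : opens X) (VU : V `<=` U) (s : sec U) :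
  pts V eta -> res VU s = 0 -> s = 0.
Proof.
move=> Veta sV.
have loc0 (x : X) : pts U x ->
    exists (W : opens X) (WU : W `<=` U), pts W x /\ res WU s = 0.
  move=> Ux; have [A [Ax affA]] := scheme_affine x.
  have [_ bas frac _] := affA.
  have [h [hx hU]] := bas (oI A U) x (@subIsetl _ _ _) (conj Ax Ux).
  have hU' : D h `<=` U by move=> y /hU[].
  exists (D h), hU'; split=> //.
  have [m [a ha]] := frac h (res hU' s).
  have domA := intX.2 A x Ax; have domh := intX.2 (D h) x hx.
  have ha0 : a = 0.
    pose W := oI V (D h).
    have WA : W `<=` A by move=> y [_ /hU[]].
    have WD : W `<=` D h by move=> y [].
    have WV : W `<=` V by move=> y [].
    have WU : W `<=` U by move=> y [/VU].
    have Weta : pts W eta.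
      by split=> //; exact: (@generic_point_open X eta x (D h) genX hx).
    apply: (affine_res_inj (VA := WA) affA domA Weta).
    have := congr1 (res WD) ha; rewrite rmorphM (res_comp _ _ WU).
    rewrite -(res_comp VU WV) sV rmorph0 mulr0.
    by rewrite (res_comp _ _ WA).
  have : res (@D_sub X A h) h ^+ m * res hU' s = 0 by rewrite ha ha0 rmorph0.
  case/domh.2=> // hm0; exfalso.
  have [V' [V'A [V'x [t ht]]]] := hx.
  have V'D : V' `<=` D h by move=> y V'y; exists V', V'A; split=> //; exists t.
  have := congr1 (res V'D) hm0; rewrite rmorphXn (res_comp _ _ V'A) rmorph0 => hm.
  have : (res V'A h * t) ^+ m = 1 by rewrite ht expr1n.
  by rewrite exprMn hm mul0r => /esym; apply: sec_nontrivial V'x.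
pose I := {W : opens X | exists WU : W `<=` U, res WU s = 0}.
apply: (@sec_sep X I U (fun i => sval i) (fun i => projT1 (cid (svalP i)))).
  by move=> x /loc0[W [WU [Wx sW]]]; exists (exist _ W (ex_intro _ WU sW)).
by move=> i; rewrite rmorph0; case: (cid _).
Qed.

End Integral.

(** * Modules, their germs and torsion-freeness *)

Section OModule.
Variables (X : ringed_space) (M : omodule X).

Lemma mresD (U V : opens X) (VU : V `<=` U) (s t : msec M U) :
  mres VU (s + t) = mres VU s + mres VU t.
Proof. by rewrite -[s]scale1r mres_linear rmorph1 !scale1r. Qed.

Lemma mres0 (U V : opens X) (VU : V `<=` U) : mres VU (0 : msec M U) = 0.
Proof. by apply: (addrI (mres VU (0 : msec M U))); rewrite -mresD !addr0. Qed.

Lemma mresZ (U V : opens X) (VU : V `<=` U) (a : sec U) (s : msec M U) :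
  mres VU (a *: s) = res VU a *: mres VU s.
Proof. by rewrite -[a *: s]addr0 mres_linear mres0 addr0. Qed.

Variables (x : X) (S : comPzRingType) (st : stalk x S) (N : lmodType S).
Variable stM : mod_stalk st M N.

Lemma mgermD (U : opens X) (Ux : pts U x) (s t : msec M U) :
  mgerm stM Ux (s + t) = mgerm stM Ux s + mgerm stM Ux t.
Proof. by rewrite -[s]scale1r mgerm_linear rmorph1 !scale1r. Qed.

Lemma mgerm0 (U : opens X) (Ux : pts U x) : mgerm stM Ux 0 = 0.
Proof. by apply: (addrI (mgerm stM Ux 0)); rewrite -mgermD !addr0. Qed.

Lemma mgermZ (U : opens X) (Ux : pts U x) (a : sec U) (s : msec M U) :
  mgerm stM Ux (a *: s) = germ st Ux a *: mgerm stM Ux s.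
Proof. by rewrite -[a *: s]addr0 mgerm_linear mgerm0 addr0. Qed.

End OModule.

Lemma line_bundle_struct_sheaf (X : ringed_space) : line_bundle (struct_sheaf X).
Proof.
move=> x; exists (oT X), 1; split=> // W WU.
by exists id => a; change (a * res WU 1 = a); rewrite rmorph1 mulr1.
Qed.

Section TorsionFree.
Variables (X : scheme) (intX : integral X) (eta : X).
Hypothesis genX : generic_point eta.
Variables (M : omodule X) (lineM : line_bundle M).

(** A local generator turns [s] into a function, and [res_generic_inj] applies. *)
Lemma mres_generic_inj (U V : opens X) (VU : V `<=` U) (s : msec M U) :
  pts V eta -> mres VU s = 0 -> s = 0.
Proof.
move=> Veta sV.
pose I := {W : opens X | exists WU : W `<=` U, mres WU s = 0}.
apply: (@msec_sep X M I U (fun i => sval i)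
  (fun i => projT1 (cid (svalP i)))); last first.
  by move=> i; rewrite mres0; case: (cid _).
move=> x Ux; have [A [e [Ax genA]]] := lineM x.
have WA : oI A U `<=` A by move=> y [].
have WU : oI A U `<=` U by move=> y [].
suff sW : mres WU s = 0 by exists (exist _ (oI A U) (ex_intro _ WU sW)).
have [c _ cK] := genA _ WA; rewrite -[mres WU s]cK /=.
suff -> : c (mres WU s) = 0 by rewrite scale0r.
have VW : oI V A `<=` oI A U by move=> y [Vy Ay]; split=> //; exact: (VU).
have VA : oI V A `<=` A by move=> y [].
have VV : oI V A `<=` V by move=> y [].
have VU' : oI V A `<=` U by move=> y [/VU].
apply: (res_generic_inj intX genX (VU := VW)).
  by split=> //; exact: (@generic_point_open X eta x A genX Ax).
have [g gK _] := genA _ VA; apply: (can_inj gK); rewrite /= scale0r.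
have := congr1 (mres VW) (cK (mres WU s)).
rewrite /= mresZ (mres_comp _ _ VA) (mres_comp _ _ VU') => ->.
by rewrite -(mres_comp VU VV) sV mres0.
Qed.

Lemma mgerm_inj (S : comPzRingType) (st : stalk eta S) (N : lmodType S)
    (stM : mod_stalk st M N) (U : opens X) (Ueta : pts U eta) (s : msec M U) :
  mgerm stM Ueta s = 0 -> s = 0.
Proof.
rewrite -(mgerm0 stM Ueta) => /mgerm_eq[V [VU [Veta]]]; rewrite mres0.
exact: mres_generic_inj.
Qed.

End TorsionFree.

(** * Charts of the projective line at its generic point *)

Section ProjectiveLine.
Variables (k : fieldType) (P : scheme_over k) (X : proj_space 1 P) (nu : P).
Hypothesis genP : generic_point nu.
Variables (K : fieldType) (stK : stalk nu K).

Lemma chart_domain i : integral_domain (sec (chart X i)).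
Proof.
have [phi [[psi phiK psiK] _ _]] := chart_poly X i.
have inj := can_inj phiK; split.
  move=> e; suff /eqP : (1 : {mpoly k[1]}) = 0 by rewrite oner_eq0.
  by apply: inj; rewrite rmorph1 rmorph0.
move=> a b ab; have /eqP : psi a * psi b = 0.
  by apply: inj; rewrite rmorphM !psiK rmorph0.
by rewrite mulf_eq0 => /orP[] /eqP e; [left; rewrite -[a]psiK | right; rewrite -[b]psiK];
  rewrite e rmorph0.
Qed.

(** An open set missing [nu] is empty and has only the zero section, unlike a chart. *)
Lemma nu_chart i : pts (chart X i) nu.
Proof.
apply: contrapT => nui; have [+ _] := chart_domain i; apply.
by apply: sec_empty => x /(generic_point_open genP).
Qed.

Lemma germ_chart_inj i (s : sec (chart X i)) : germ stK (nu_chart i) s = 0 -> s = 0.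
Proof.
rewrite -(rmorph0 (germ stK (nu_chart i))) => /germ_eq[V [VU [Vnu]]]; rewrite rmorph0.
exact: affine_res_inj (chart_affine X i) (chart_domain i) Vnu.
Qed.

End ProjectiveLine.

(** * The generic fibre of a split pushforward *)

Lemma generator_expand (X : ringed_space) (M : omodule X) (U W : opens X)
    (e : msec M U) (WU : W `<=` U) (s : msec M W) :
  generator e -> exists c : sec W, s = c *: mres WU e.
Proof. by move=> /(_ W WU)[g _ gK]; exists (g s); rewrite gK. Qed.

Lemma generator_inj (X : ringed_space) (M : omodule X) (U W : opens X)
    (e : msec M U) (WU : W `<=` U) (c : sec W) :
  generator e -> c *: mres WU e = 0 -> c = 0.
Proof.
by move=> /(_ W WU)[g gK _] ce; apply: (can_inj gK); rewrite /= ce scale0r.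
Qed.

Section GenericFibre.
Variables (k : fieldType) (C P : scheme_over k) (X : proj_space 1 P) (f : smor C P).
Variables (eta : C) (nu : P).
Hypotheses (genC : generic_point eta) (genP : generic_point nu).

(** The splitting forces [f] to be dominant: a preimage missing [eta] is empty, so the pushforward
    vanishes on [W], whereas the summands have nonzero generators there. *)
Lemma splitting_generic_point (M : omodule C) (n : nat) (a : 'I_n -> int)
    (sp : splitting X (pushforward f M) a) (p : 'I_n) (V : opens P) :
  pts V nu -> pts (opre f V) eta.
Proof.
move=> Vnu; apply: contrapT => Veta.
pose e q := projT1 (cid (summand_twist sp q)).
have gen q i : generator (e q i) by case: (projT2 (cid (summand_twist sp q))).
pose W := oI V (chart X 0).
have WX : W `<=` chart X 0 by move=> y [].
have Wnu : pts W nu by split=> //; apply: nu_chart.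
have empty (s t : msec M (opre f W)) : s = t.
  apply: msec_empty => y [Vy _]; apply: Veta.
  exact: (@generic_point_open C eta y (opre f V) genC Vy).
have [t [_ uniq]] := incl_iso sp (0 : msec (pushforward f M) W).
have t0 := uniq (fun=> 0) (empty _ _).
have te := uniq (fun q => mres WX (e q 0)) (empty _ _).
have := congr1 (fun u => u p) (etrans (esym te) t0); rewrite -[LHS]scale1r.
by move/(generator_inj (gen p 0)); apply: sec_nontrivial Wnu.
Qed.

Variables (K : fieldType) (L : fieldExtType K).
Variables (stK : stalk nu K) (stL : stalk eta L).
Hypothesis nu_eta : forall V : opens P, pts V nu -> pts (opre f V) eta.
Hypothesis hKL : forall (V : opens P) (Vnu : pts V nu) (Veta : pts (opre f V) eta)
  (s : sec V), germ stL Veta (pull f V s) = (germ stK Vnu s)%:A.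

Section Germ.
Variables (M : omodule C) (stM : mod_stalk stL M L^o).
Local Notation E := (pushforward f M).

Definition pgerm (V : opens P) (Vnu : pts V nu) (s : msec E V) : L :=
  mgerm stM (nu_eta Vnu) s.

Lemma pgermD (V : opens P) (Vnu : pts V nu) (s t : msec E V) :
  pgerm Vnu (s + t) = pgerm Vnu s + pgerm Vnu t.
Proof. exact: (mgermD stM (nu_eta Vnu) s t). Qed.

Lemma pgerm0 (V : opens P) (Vnu : pts V nu) : pgerm Vnu (0 : msec E V) = 0.
Proof. exact: (mgerm0 stM (nu_eta Vnu)). Qed.

Lemma pgerm_sum (V : opens P) (Vnu : pts V nu) n (s : 'I_n -> msec E V) :
  pgerm Vnu (\sum_p s p) = \sum_p pgerm Vnu (s p).
Proof. by elim/big_rec2: _ => [|p z t _ <-]; rewrite ?pgerm0 ?pgermD. Qed.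

Lemma pgermZ (V : opens P) (Vnu : pts V nu) (c : sec V) (s : msec E V) :
  pgerm Vnu (c *: s) = germ stK Vnu c *: pgerm Vnu s.
Proof.
rewrite /pgerm; have -> : c *: s = pull f V c *: s :> msec M (opre f V) by [].
by rewrite mgermZ (hKL Vnu) -[in RHS]mulr_algl.
Qed.

Lemma pgerm_res (V W : opens P) (WV : W `<=` V) (Vnu : pts V nu)
    (Wnu : pts W nu) (s : msec E V) : pgerm Wnu (mres WV s) = pgerm Vnu s.
Proof.
exact: (@mgerm_res _ _ _ _ _ _ stM _ _ (@opre_sub C P f V W WV)
  (nu_eta Vnu) (nu_eta Wnu) s).
Qed.

Variables (intC : integral C) (lineM : line_bundle M).

Lemma pgerm_inj (V : opens P) (Vnu : pts V nu) (s : msec E V) :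
  pgerm Vnu s = 0 -> s = 0.
Proof. exact: (mgerm_inj intC genC lineM (stM := stM) (Ueta := nu_eta Vnu)). Qed.

(** Finitely many germs live on one neighbourhood, shrunk one index at a time. *)
Lemma germ_family n (kappa : 'I_n -> K) (U : opens P) : pts U nu ->
  exists (V : opens P) (VU : V `<=` U) (Vnu : pts V nu) (c : 'I_n -> sec V),
    forall p, germ stK Vnu (c p) = kappa p.
Proof.
move=> Unu; suff H (s : seq 'I_n) :
    exists (V : opens P) (VU : V `<=` U) (Vnu : pts V nu) (c : 'I_n -> sec V),
      forall p, p \in s -> germ stK Vnu (c p) = kappa p.
  have [V [VU [Vnu [c cE]]]] := H (enum 'I_n).
  by exists V, VU, Vnu, c => p; rewrite cE // mem_enum.
elim: s => [|q s [V [VU [Vnu [c cE]]]]].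
  by exists U, (fun _ h => h), Unu, (fun=> 0).
have [V' [V'nu [c' c'E]]] := germ_surj stK (kappa q).
have WV : oI V V' `<=` V by move=> y [].
have WV' : oI V V' `<=` V' by move=> y [].
have Wnu : pts (oI V V') nu by [].
exists (oI V V'), (fun y h => VU y (WV y h)), Wnu.
exists (fun p => if p == q then res WV' c' else res WV (c p)) => p.
rewrite inE; case: eqP => [-> _|_ /= ps]; first by rewrite germ_res c'E.
by rewrite germ_res cE.
Qed.

Section Splitting.
Variables (n : nat) (a : 'I_n -> int) (sp : splitting X E a).

Definition gen_sec q i : msec (summand sp q) (chart X i) :=
  projT1 (cid (summand_twist sp q)) i.

Lemma gen_secP q i : generator (gen_sec q i).
Proof. by case: (projT2 (cid (summand_twist sp q))). Qed.

Arguments gen_secP : clear implicits.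

(** For [i = 0] this is the basis of [L] over [K] given by the splitting; [gen_germ1] gives its
    rescaling for [i = 1]. *)
Definition gen_germ q i : L :=
  pgerm (nu_chart X genP i) (incl sp q (chart X i) (gen_sec q i)).

Definition xgerm : K := germ stK (nu_chart X genP 0) (Defs.coord X 0 1).

Lemma xgermM : xgerm * germ stK (nu_chart X genP 1) (Defs.coord X 1 0) = 1.
Proof.
pose W := oI (chart X 0) (chart X 1).
have W0 : W `<=` chart X 0 by move=> y [].
have W1 : W `<=` chart X 1 by move=> y [].
have Wnu : pts W nu by split; apply: nu_chart.
have := @coord_cocycle _ _ _ X 0 1 0 W W0 W1; rewrite coord_diag rmorph1.
move=> /(congr1 (germ stK Wnu)); rewrite rmorphM rmorph1.
by rewrite !(germ_res _ _ (nu_chart X genP _)) => <-.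
Qed.

Lemma xgermV : germ stK (nu_chart X genP 1) (Defs.coord X 1 0) = xgerm^-1.
Proof. exact/esym/mulr1_eq/xgermM. Qed.

Lemma gen_germ1 q : gen_germ q 1 = xgerm ^ (- a q) *: gen_germ q 0.
Proof.
pose W := oI (chart X 0) (chart X 1).
have W0 : W `<=` chart X 0 by move=> y [].
have W1 : W `<=` chart X 1 by move=> y [].
have Wnu : pts W nu by split; apply: nu_chart.
have := (projT2 (cid (summand_twist sp q))).2 0 1 W W0 W1.
rewrite -/(gen_sec q 0) -/(gen_sec q 1) => /(congr1 (fun s => pgerm Wnu (incl sp q W s))).
rewrite linearZ /= pgermZ !hom_res !(pgerm_res _ (nu_chart X genP _)) /gen_germ => ->.
(* [twist] uses [X_1 / X_0] for nonnegative exponents and its inverse for negative ones. *)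
congr (_ *: _); case: (- a q) => m.
  by rewrite rmorphXn /= (germ_res _ _ (nu_chart X genP _)).
by rewrite rmorphXn /= (germ_res _ _ (nu_chart X genP _)) xgermV exprVn.
Qed.

Lemma pgerm_incl q i (W : opens P) (WU : W `<=` chart X i) (Wnu : pts W nu) (c : sec W) :
  pgerm Wnu (incl sp q W (c *: mres WU (gen_sec q i))) = germ stK Wnu c *: gen_germ q i.
Proof.
by rewrite linearZ /= pgermZ hom_res (pgerm_res _ (nu_chart X genP i)).
Qed.

(** The coefficients spread out to one open [V], where injectivity of germs gives a relation of
    sections; uniqueness in [incl_iso] kills each term. *)
Lemma gen_germ_free (kappa : 'I_n -> K) :
  \sum_q kappa q *: gen_germ q 0 = 0 -> forall q, kappa q = 0.
Proof.
have [V [VU [Vnu [c cE]]]] := germ_family kappa (nu_chart X genP 0).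
under eq_bigr => q _ do rewrite -cE -(pgerm_incl _ VU).
rewrite -pgerm_sum => /pgerm_inj s0 q.
have [t [_ uniq]] := incl_iso sp (0 : msec E V).
have := congr1 (fun u => u q) (etrans (esym (uniq _ (esym s0))) (uniq (fun=> 0) _)).
rewrite -cE => /= t0; rewrite (generator_inj (gen_secP q 0) (t0 _)) ?rmorph0 //.
by rewrite big1 // => p _; rewrite linear0.
Qed.

Lemma pgerm_chart i (s : msec E (chart X i)) : exists c : 'I_n -> sec (chart X i),
  pgerm (nu_chart X genP i) s =
    \sum_q germ stK (nu_chart X genP i) (c q) *: gen_germ q i.
Proof.
have [t [-> _]] := incl_iso sp s.
have h q := cid (generator_expand (fun _ h => h) (t q) (gen_secP q i)).
exists (fun q => projT1 (h q)); rewrite pgerm_sum; apply: eq_bigr => q _.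
by rewrite -(pgerm_incl q (fun _ h => h)); congr pgerm; case: (h q) => c /= <-.
Qed.

(** This reduces the stalks in [filtration] to spans of the first [i + 1] basis elements. *)
Lemma mem_filtration i (z : L) : filtration sp stM nu i z <->
  exists kappa : 'I_n -> K, (forall q : 'I_n, (i < q)%N -> kappa q = 0) /\
    z = \sum_q kappa q *: gen_germ q 0.
Proof.
split.
  move=> [V [Vnu [Veta [t [t0 ->]]]]].
  have -> : Veta = nu_eta Vnu by exact: Prop_irrelevance.
  rewrite -/(pgerm Vnu _) pgerm_sum.
  pose W := oI V (chart X 0).
  have WV : W `<=` V by move=> y [].
  have WU : W `<=` chart X 0 by move=> y [].
  have Wnu : pts W nu by split=> //; apply: nu_chart.
  have h q := cid (generator_expand WU (mres WV (t q)) (gen_secP q 0)).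
  exists (fun q : 'I_n => if (i < q)%N then 0 else germ stK Wnu (projT1 (h q))).
  split=> [q -> //|].
  apply: eq_bigr => q _; case: ltnP => [iq|_].
    by rewrite t0 // linear0 pgerm0 scale0r.
  rewrite -(pgerm_incl q WU); case: (h q) => c /= <-.
  by rewrite hom_res (pgerm_res _ Vnu).
move=> [kappa [kappa0 ->]].
have [V [VU [Vnu [c cE]]]] := germ_family kappa (nu_chart X genP 0).
exists V, Vnu, (nu_eta Vnu).
exists (fun q : 'I_n => if (i < q)%N then 0 else c q *: mres VU (gen_sec q 0)).
split=> [q -> //|]; rewrite -/(pgerm Vnu _) pgerm_sum; apply: eq_bigr => q _.
case: ltnP => [iq|_]; first by rewrite linear0 pgerm0 kappa0 // scale0r.
by rewrite pgerm_incl cE.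
Qed.

End Splitting.
End Germ.
End GenericFibre.

(** * Degree comparison between the two charts *)

Section Vanishing.
Variables (k : fieldType) (P : scheme_over k) (X : proj_space 1 P) (nu : P).
Hypothesis genP : generic_point nu.
Variables (K : fieldType) (stK : stalk nu K).
Local Notation x := (xgerm X genP stK).

Lemma germ_scal i c :
  germ stK (nu_chart X genP i) (scal (chart X i) c) =
    germ stK (I : pts (oT P) nu) (kstr P c).
Proof. by rewrite /scal (germ_res _ _ (I : pts (oT P) nu)). Qed.

(* As h1 'X_0 is the inverse of h0 'X_0, q is p with its coefficients reversed. *)
Lemma mpoly_reverse (h0 h1 : {rmorphism {mpoly k[1]} -> K}) (p : {mpoly k[1]}) :
    (forall c, h1 c%:MP = h0 c%:MP) -> h1 'X_0 * h0 'X_0 = 1 ->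
  exists (q : {mpoly k[1]}) (d : nat), (msize q <= d.+1)%N /\ h1 p * h0 'X_0 ^+ d = h0 q.
Proof.
move=> hC hX; pose d := msize p.
exists (\sum_(m <- msupp p) p@_m *: 'X_0 ^+ (d - m ord0)), d; split.
  apply: (leq_trans (mmeasure_sum _ _ _ _)).
  apply/bigmax_leqP_seq => m _ _; apply: (leq_trans (msizeZ_le _ _)).
  by rewrite mpolyXn msizeX mdegMn mdeg1 mul1n ltnS leq_subr.
rewrite {1}[p]mpolyE !rmorph_sum mulr_suml /=.
rewrite big_seq [RHS]big_seq; apply: eq_bigr => m mp.
rewrite -!mul_mpolyC !rmorphM hC /= -mulrA; congr (_ * _).
have md : (m ord0 <= d)%N.
  apply: leq_trans (ltnW (msize_mdeg_lt mp)).
  by rewrite mdegE big_ord1.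
rewrite mpolyXE_id big_ord1 !rmorphXn /= -{1}(subnKC md) exprD mulrA -exprMn hX.
by rewrite expr1n mul1r.
Qed.

(** Here [c0] is a polynomial [p] in [x], and [c1] is [q / x^d] with [q] of degree at most [d]. Then
    [p x^(e+1+d) = q], which forces [p = 0]. *)
Lemma germ_chart_vanish (c0 : sec (chart X 0)) (c1 : sec (chart X 1)) e :
    germ stK (nu_chart X genP 0) c0 = x^-1 ^+ e.+1 * germ stK (nu_chart X genP 1) c1 ->
  germ stK (nu_chart X genP 0) c0 = 0.
Proof.
have [phi0 [[psi0 phi0K psi0K] phi0C phi0X]] := chart_poly X 0.
have [phi1 [[psi1 phi1K psi1K] phi1C phi1X]] := chart_poly X 1.
pose h0 : {rmorphism {mpoly k[1]} -> K} := germ stK (nu_chart X genP 0) \o phi0.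
pose h1 : {rmorphism {mpoly k[1]} -> K} := germ stK (nu_chart X genP 1) \o phi1.
have x0 : h0 'X_0 = x.
  rewrite /h0 /= phi0X /xgerm; congr (germ _ _ (Defs.coord _ _ _)); exact: val_inj.
have x1 : h1 'X_0 = x^-1.
  rewrite /h1 /= phi1X -xgermV; congr (germ _ _ (Defs.coord _ _ _)); exact: val_inj.
have xx : x^-1 * x = 1.
  by rewrite mulrC -xgermV xgermM.
have hC c : h1 c%:MP = h0 c%:MP by rewrite /h0 /h1 /= phi0C phi1C !germ_scal.
have [||q [d [szq hq]]] := @mpoly_reverse h0 h1 (psi1 c1) => //.
  by rewrite x0 x1.
move=> ec; have e01 : h0 (psi0 c0) = x^-1 ^+ e.+1 * h1 (psi1 c1).
  by rewrite /h0 /h1 /= psi0K psi1K.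

have h0inj p : h0 p = 0 -> p = 0.
  by move=> /germ_chart_inj p0; rewrite -[p]phi0K p0 -(rmorph0 phi0) phi0K.
have : psi0 c0 * 'X_0 ^+ (e.+1 + d) = q.
  apply/eqP; rewrite -subr_eq0; apply/eqP/h0inj.
  by rewrite rmorphB rmorphM rmorphXn -hq e01 x0 exprD
    mulrACA -exprMn xx expr1n mul1r subrr.
have [c00 _|p0 eq] := eqVneq (psi0 c0) 0; first by rewrite -[c0]psi0K c00 !rmorph0.
have X0 N : 'X_0 ^+ N != 0 :> {mpoly k[1]}.
  by rewrite mpolyXn -msize_poly_eq0 msizeX.
exfalso; have := szq; rewrite -eq msizeM // mpolyXn msizeX mdegMn mdeg1 mul1n.
have : (0 < msize (psi0 c0))%N by rewrite lt0n msize_poly_eq0.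
by move: (msize _) => r; clear; lia.
Qed.

End Vanishing.

(** * Structure constants of the multiplication *)

Section Product.
Variables (k : fieldType) (C P : scheme_over k) (X : proj_space 1 P) (f : smor C P).
Variables (eta : C) (nu : P).
Hypotheses (genC : generic_point eta) (genP : generic_point nu).
Variables (K : fieldType) (L : fieldExtType K).
Variables (stK : stalk nu K) (stL : stalk eta L).
Hypothesis nu_eta : forall V : opens P, pts V nu -> pts (opre f V) eta.
Hypothesis hKL : forall (V : opens P) (Vnu : pts V nu) (Veta : pts (opre f V) eta)
  (s : sec V), germ stL Veta (pull f V s) = (germ stK Vnu s)%:A.
Variables (M : omodule C) (stM : mod_stalk stL M L^o).
Variables (intC : integral C) (lineM : line_bundle M).

Lemma pgerm_mul (V : opens P) (Vnu : pts V nu)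
    (s : sec (opre f V)) (t : msec M (opre f V)) :
  pgerm nu_eta stM Vnu (s *: t) =
    pgerm nu_eta (struct_stalk stL) Vnu s * pgerm nu_eta stM Vnu t.
Proof. exact: (mgermZ stM (nu_eta Vnu) s t). Qed.

Variables (n : nat) (a b : 'I_n -> int).
Variables (spO : splitting X (pushforward f (struct_sheaf C)) a).
Variables (spM : splitting X (pushforward f M) b).
Local Notation x := (xgerm X genP stK).
Local Notation EO := (gen_germ genP nu_eta (struct_stalk stL) spO).
Local Notation EM := (gen_germ genP nu_eta stM spM).

Lemma gen_germ_product p q : exists kappa : 'I_n -> K,
  (forall l, a p + b q < b l -> kappa l = 0) /\
  EO p 0 * EM q 0 = \sum_l kappa l *: EM l 0.
Proof.
have chart_product i : exists c : 'I_n -> sec (chart X i),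
    EO p i * EM q i = \sum_l germ stK (nu_chart X genP i) (c l) *: EM l i.
  rewrite -(pgerm_mul (nu_chart X genP i)).
  exact: (pgerm_chart genP nu_eta hKL stM spM).
have [c0 c0E] := chart_product 0; have [c1 c1E] := chart_product 1.
exists (fun l => germ stK (nu_chart X genP 0) (c0 l)); split=> // l abl.
have x0 : x != 0.
  by apply/eqP=> x0; have /eqP := xgermM X genP stK; rewrite x0 mul0r eq_sym oner_eq0.
move: c1E; rewrite !(gen_germ1 genP nu_eta hKL).
rewrite -scalerAl -scalerAr scalerA c0E scaler_sumr.
move/eqP; rewrite -subr_eq0 -sumrB.
under eq_bigr => r _ do rewrite (gen_germ1 genP nu_eta hKL) !scalerA -scalerBl.
move/eqP/(gen_germ_free genC hKL intC lineM)/(_ l)/eqP; rewrite subr_eq0 => /eqP el.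
have : germ stK (nu_chart X genP 0) (c0 l) =
    x ^ (a p + b q - b l) * germ stK (nu_chart X genP 1) (c1 l).
  apply: (mulfI (x := x ^ (- a p) * x ^ (- b q))).
    by rewrite mulf_neq0 // expfz_neq0.
  rewrite el mulrA mulrC -!expfzDr //; congr (_ ^ _ * _); lia.
have : a p + b q - b l < 0 by rewrite subr_lt0.
(* A negative exponent is [Negz e], that is [-(e + 1)]. *)
case: (_ - _) => // e _; rewrite /exprz -exprVn.
exact: germ_chart_vanish.
Qed.

End Product.

(** * Linear algebra of the two flags *)

Section Flags.
Variables (K : fieldType) (L : fieldExtType K) (n : nat) (A B : 'I_n -> L).
Variables (a b : 'I_n -> int).
Hypothesis le_a : forall p q : 'I_n, (p <= q)%N -> a p <= a q.
Hypothesis le_b : forall p q : 'I_n, (p <= q)%N -> b p <= b q.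
Hypothesis free_A : forall kappa : 'I_n -> K,
  \sum_p kappa p *: A p = 0 -> forall p, kappa p = 0.
Hypothesis free_B : forall kappa : 'I_n -> K,
  \sum_p kappa p *: B p = 0 -> forall p, kappa p = 0.
Hypothesis mul_AB : forall p q, exists kappa : 'I_n -> K,
  (forall l, a p + b q < b l -> kappa l = 0) /\ A p * B q = \sum_l kappa l *: B l.

Definition flag (E : 'I_n -> L) (i : 'I_n) : set L :=
  [set z | exists kappa : 'I_n -> K, (forall q : 'I_n, (i < q)%N -> kappa q = 0) /\
     z = \sum_q kappa q *: E q].

Lemma flag_gen E i : flag E i (E i).
Proof.
exists (fun q => (q == i)%:R); split=> [q|].
  by case: eqP => // ->; rewrite ltnn.
rewrite (bigD1 i) //= eqxx scale1r big1 ?addr0 // => q /negPf ->.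
by rewrite scale0r.
Qed.

Lemma free_neq0 (E : 'I_n -> L) i :
    (forall kappa : 'I_n -> K, \sum_p kappa p *: E p = 0 -> forall p, kappa p = 0) ->
  E i != 0.
Proof.
move=> freeE; apply/eqP=> Ei0.
have /freeE/(_ i)/eqP : \sum_q (q == i)%:R *: E q = 0.
  by apply: big1 => q _; case: eqP => [->|_]; rewrite ?Ei0 ?scaler0 ?scale0r.
by rewrite eqxx oner_eq0.
Qed.

(** By monotonicity, [a i + b j] bounds every [a p + b q] that occurs. *)
Lemma flag_mul i j z w : flag A i z -> flag B j w ->
  exists kappa : 'I_n -> K,
    (forall l, a i + b j < b l -> kappa l = 0) /\ z * w = \sum_l kappa l *: B l.
Proof.
move=> [u [u0 ->]] [v [v0 ->]].
have [c cP] : exists c : 'I_n -> 'I_n -> 'I_n -> K, forall p q,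
    (forall l, a p + b q < b l -> c p q l = 0) /\ A p * B q = \sum_l c p q l *: B l.
  by exists (fun p q => projT1 (cid (mul_AB p q))) => p q; case: (cid (mul_AB p q)).
exists (fun l => \sum_p \sum_q u p * v q * c p q l); split=> [l ijl|].
  apply: big1 => p _; apply: big1 => q _.
  case: (leqP p i) => [pi|/u0 ->]; last by rewrite !mul0r.
  case: (leqP q j) => [qj|/v0 ->]; last by rewrite mulr0 mul0r.
  rewrite (cP p q).1 ?mulr0 //.
  by apply: le_lt_trans ijl; rewrite lerD ?le_a ?le_b.
under [RHS]eq_bigr => l _ do rewrite scaler_suml.
rewrite exchange_big mulr_suml /=; apply: eq_bigr => p _.
under [RHS]eq_bigr => l _ do rewrite scaler_suml.
rewrite exchange_big mulr_sumr /=; apply: eq_bigr => q _.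
rewrite -scalerAl -scalerAr scalerA (cP p q).2 scaler_sumr.
by apply: eq_bigr => l _; rewrite scalerA.
Qed.

Lemma minimal_flag_le (i j m : 'I_n) :
    set_mul (flag A i) (flag B j) `<=` flag B m ->
    (forall l : 'I_n, set_mul (flag A i) (flag B j) `<=` flag B l -> (m <= l)%N) ->
  b m <= a i + b j.
Proof.
move=> _ minm; rewrite leNgt; apply/negP=> ltm.
have big_zero z w : flag A i z -> flag B j w ->
    exists kappa : 'I_n -> K, (forall l : 'I_n, (m <= l)%N -> kappa l = 0) /\
      z * w = \sum_l kappa l *: B l.
  move=> iz jw; have [kappa [k0 ->]] := flag_mul iz jw; exists kappa; split=> // l ml.
  by apply: k0; apply: lt_le_trans ltm (le_b ml).
(* For [m = 0] the nonzero product [A i * B j] would vanish; otherwise all products already lie in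
   the flag of index [m - 1]. *)
have [m0|m0] := posnP m.
  have [kappa [k0 /eqP]] := big_zero _ _ (flag_gen A i) (flag_gen B j).
  rewrite big1 => [|l _]; last by rewrite k0 ?m0 ?scale0r.
  by rewrite mulf_eq0 !(negPf (free_neq0 _ _)).
have lt_m1 : (m.-1 < n)%N by rewrite (leq_ltn_trans (leq_pred m)).
have /minm : set_mul (flag A i) (flag B j) `<=` flag B (Ordinal lt_m1).
  move=> _ [z iz [w jw <-]]; have [kappa [k0 ->]] := big_zero z w iz jw.
  by exists kappa; split=> // q; rewrite /= prednK // => /k0.
by rewrite /= leqNgt prednK // leqnn.
Qed.

(** Index shift: [flag E i] corresponds to [flagv E i.+1]. *)
Definition flagv (E : 'I_n -> L) i : {vspace L} :=
  <<[seq E p | p <- take i (enum 'I_n)]>>%VS.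

Lemma mem_take_enum i (p : 'I_n) : (p \in take i (enum 'I_n)) = (p < i)%N.
Proof. by rewrite in_take ?mem_enum // index_enum_ord. Qed.

Lemma dim_flagv E i :
    (forall kappa : 'I_n -> K, \sum_p kappa p *: E p = 0 -> forall p, kappa p = 0) ->
  (i <= n)%N -> \dim (flagv E i) = i.
Proof.
move=> freeE lein.
have fE : free [seq E p | p <- enum 'I_n].
  have -> : [seq E p | p <- enum 'I_n] = [tuple E p | p < n].
    by rewrite -(val_ord_tuple n).
  apply/freeP=> c c0 p; apply: (freeE c).
  by rewrite -[RHS]c0; apply: eq_bigr => q _; rewrite -tnth_nth tnth_mktuple.
have : free [seq E p | p <- take i (enum 'I_n)].
  by move: fE; rewrite -{1}[enum _](cat_take_drop i) map_cat => /catl_free.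
by rewrite /free => /eqP ->; rewrite size_map size_takel // size_enum_ord.
Qed.

(** From index [ij] on, [b l] exceeds every relevant [a p + b q], so the products lie in the span of
    the first [i + j] vectors. *)
Lemma dim_flagv_mul (i j ij : 'I_n) : (ij : nat) = (i + j)%N -> a i + b j < b ij ->
  (\dim (flagv A i.+1 * flagv B j.+1) <= i + j)%N.
Proof.
move=> ijE ltb; rewrite -ijE -[in leqRHS](dim_flagv free_B (ltnW (ltn_ord ij))).
apply/dimvS/prodvP=> z w.
have AB (p q : 'I_n) : (p <= i)%N -> (q <= j)%N -> A p * B q \in flagv B ij.
  move=> pi qj; have [kappa [k0 ->]] := mul_AB p q.
  apply: memv_suml => l _; case: (ltnP l ij) => [lij|ijl].
    by apply/memvZ/memv_span/map_f; rewrite mem_take_enum.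
  rewrite k0 ?scale0r ?mem0v //; apply: le_lt_trans (lt_le_trans ltb (le_b ijl)).
  by rewrite lerD ?le_a ?le_b.
move=> zA wB.
have zAB (p : 'I_n) : (p <= i)%N -> A p * w \in flagv B ij.
  move=> pi; have : (flagv B j.+1 <= amull (A p) @^-1: flagv B ij)%VS.
    apply/span_subvP=> _ /mapP[q + ->]; rewrite mem_take_enum => qj.
    by rewrite -memv_preim lfunE /= AB.
  by move=> /subvP/(_ _ wB); rewrite -memv_preim lfunE.
have : (flagv A i.+1 <= amulr w @^-1: flagv B ij)%VS.
  apply/span_subvP=> _ /mapP[q + ->]; rewrite mem_take_enum => qj.
  by rewrite -memv_preim lfunE /= zAB.
by move=> /subvP/(_ _ zA); rewrite -memv_preim lfunE.
Qed.

End Flags.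

Theorem theorem1p43 (k : fieldType) (g n : nat)
  (C : scheme_over k) (hC : smooth_projective_curve g C)
  (P : scheme_over k) (X : proj_space 1 P)
  (f : smor C P) (hf : kmor f) (ffin : finite_mor f)
  (M : omodule C) (hM : line_bundle M)
  (eta : C) (heta : generic_point eta) (nu : P) (hnu : generic_point nu)
  (K : fieldType) (L : fieldExtType K)
  (stK : stalk nu K) (stL : stalk eta L)
  (hKL : forall (V : opens P) (Vnu : pts V nu) (Veta : pts (opre f V) eta)
           (s : sec V), germ stL Veta (pull f V s) = (germ stK Vnu s)%:A)
  (hdeg : \dim {:L} = n) (hn : (2 <= n)%N)
  (stM : mod_stalk stL M L^o)
  (a b : 'I_n -> int)
  (spO : splitting X (pushforward f (struct_sheaf C)) a)
  (spM : splitting X (pushforward f M) b) :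
  let F := filtration spO (struct_stalk stL) nu in
  let G := filtration spM stM nu in
  (forall i j k' : 'I_n,
     set_mul (F i) (G j) `<=` G k' ->
     (forall l : 'I_n, set_mul (F i) (G j) `<=` G l -> (k' <= l)%N) ->
     b k' <= a i + b j) /\
  (forall i j ij : 'I_n, (ij : nat) = (i + j)%N ->
     a i + b j < b ij ->
     exists m : nat, (1 < m < n)%N /\
       (exists E : {subfield L}, \dim E = m) /\
       (i %% m + j %% m)%N <> ((i + j) %% m)%N).
Proof.
move=> F G.
have intC := geometrically_integral_integral (curve_geom_integral hC).
(* The bound on [n] supplies the index 0 of a summand. *)
have nu_eta := splitting_generic_point heta hnu spO (Ordinal (ltnW hn)).
pose A p := gen_germ hnu nu_eta (struct_stalk stL) spO p 0.
pose B p := gen_germ hnu nu_eta stM spM p 0.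
have FE : F = flag A.
  by apply/funext=> i; apply/seteqP; split=> z /(mem_filtration hnu nu_eta hKL).
have GE : G = flag B.
  by apply/funext=> i; apply/seteqP; split=> z /(mem_filtration hnu nu_eta hKL).
have freeA (kappa : 'I_n -> K) : \sum_p kappa p *: A p = 0 -> forall p, kappa p = 0.
  exact: (gen_germ_free heta hKL intC (@line_bundle_struct_sheaf C)).
have freeB (kappa : 'I_n -> K) : \sum_p kappa p *: B p = 0 -> forall p, kappa p = 0.
  exact: (gen_germ_free heta hKL intC hM).
have mulAB := gen_germ_product heta hnu nu_eta hKL stM intC hM spO spM.
have le_a := splitting_sorted spO; have le_b := splitting_sorted spM.
split=> [i j m|i j ij ijE ltb].
  by rewrite FE GE; apply: minimal_flag_le le_a le_b freeA freeB mulAB _ _ _.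
have [||||m [mn subf carry]] := @carry_subfield _ _ (flagv A i.+1) (flagv B j.+1) i j.
- exact: dim_flagv.
- exact: dim_flagv.
- by rewrite hdeg -ijE.
- exact: dim_flagv_mul le_a le_b freeB mulAB _ _ _ ijE ltb.
by exists m; split; first by move: mn; rewrite hdeg.
Qed.
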